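(* Let $\boldsymbol\kappa\in\mathbb Z^\ell$ be a multicharge, $\Lambda=\Lambda_{\kappa_1}+\dots+\Lambda_{\kappa_\ell}$, and $\beta\in\mathbb Z_{\ge0}I$. The cyclotomic KLR algebra $R^\Lambda_\beta$ is a RoCK block (resp. a core block) if and only if there exists a convex preorder $\succeq$ on $\Phi_+$ such that, for every multipartition $\boldsymbol\lambda$ of multicharge $\boldsymbol\kappa$ with $\mathrm{cont}(\boldsymbol\lambda)=\beta$, the cuspidal Kostant tiling $\Gamma_{\boldsymbol\lambda}$ consists only of tiles with content $\succeq\delta$ (resp. $\succ\delta$).
   Context: **Roots.** Fix an integer $e\ge2$, $\mathbb Z_e=\mathbb Z/e\mathbb Z$; $\bar t$ is the class of $t\in\mathbb Z$, also identified with its representative in $[0,e-1]$. $\mathbb ZI$ is the free abelian group on $I=\{\alpha_i:i\in\mathbb Z_e\}$, $\mathbb Z_{\ge0}I$ the nonnegative combinations. For $t\in\mathbb Z,L\ge1$: $\alpha(t,L)=\alpha_{\bar t}+\dots+\alpha_{\overline{t+L-1}}$; $\delta=\sum_i\alpha_i$; $\Phi_+=\{\alpha(t,L)\}$ (positive roots). A convex preorder on $\Phi_+$ is a reflexive, transitive, total relation $\succeq$ such that $\beta\succeq\gamma$, $\beta+\gamma\in\Phi_+$ imply $\beta\succeq\beta+\gamma\succeq\gamma$, and such that ($\beta\succeq\gamma$ and $\gamma\succeq\beta$) iff $\beta=\gamma$ or $\beta,\gamma\in\{m\delta:m\ge1\}$. $\beta\succ\gamma$ means $\beta\succeq\gamma$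 and not $\gamma\succeq\beta$. **Diagrams.** Nodes are elements $(x,y)\in\mathbb Z\times\mathbb Z$ (row $x$ increasing southward, column $y$ eastward), $\mathrm{res}(x,y)=\overline{y-x}$; $(x,y)\searrow(x',y')$ iff $x\le x',y\le y'$. $\mathcal N_\ell$ is the disjoint union of $\ell$ copies (components) of $\mathbb Z\times\mathbb Z$. A skew diagram in $\mathcal N_\ell$ is a finite subset $\tau$ such that in each component $u\searrow v\searrow w$, $u,w\in\tau$ imply $v\in\tau$. A partition of charge $\kappa$ is a skew diagram in one component that is empty or contains $(1,\kappa+1)$ with $(1,\kappa+1)\searrow u$ for all its nodes $u$; $\lambda_a$ is the number of nodes in row $a$. A multipartition of multicharge $\boldsymbol\kappa=(\kappa_1,\dots,\kappa_\ell)$ is $\boldsymbol\lambda=(\lambda^{(1)}|\cdots|\lambda^{(\ell)})$ with $\lambda^{(r)}$ a partition of charge $\kappa_r$. $\mathrm{cont}(S)=\sum_{u\in S}\alpha_{\mathrm{res}(u)}$; $\Lambda_+^{\boldsymbol\kappa}(\beta)$ is the set of multipartitions of multicharge $\boldsymbol\kappa$ and content $\beta$. **RoCK and core blocks.** $\mathcal B^r(\boldsymbol\lambda,\boldsymbol\kappa)=\{\bar\kappa_r+\lambda^{(r)}_a-a:a\ge1\}$ with $\bar\kappa_r\in[0,e-1]$. A residue permutation is a permutation $\theta=(\theta_1,\dots,\theta_e)$ of $[0,e-1]$. $\boldsymbol\lambda$ is $(\boldsymbol\kappa,\theta)$-RoCK if whenever $y\in\mathcal B^r(\boldsymbol\lambda,\boldsymbol\kappa)$,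 $x\notin\mathcal B^r(\boldsymbol\lambda,\boldsymbol\kappa)$ for some $r$ and $x<y$ with $\bar x=\theta_a$, $\bar y=\theta_b$, then $a\le b$. $\boldsymbol\lambda$ is a multicore if $x\in\mathcal B^r$ implies $x-e\in\mathcal B^r$ for all $r$ (no removable $e$-ribbons). $R^\Lambda_\beta$ is called a RoCK block if there is a $\theta$ such that every element of $\Lambda_+^{\boldsymbol\kappa}(\beta)$ is $(\boldsymbol\kappa,\theta)$-RoCK; it is called a core block if every element of $\Lambda_+^{\boldsymbol\kappa}(\beta)$ is a multicore. ($R^\Lambda_\beta$ is the type $\mathtt A^{(1)}_{e-1}$ cyclotomic KLR algebra of weight $\Lambda$; only these combinatorial definitions are used in the statement.) **Tilings.** A skew tiling $\Gamma$ of a skew diagram $\tau$ is a set of pairwise disjoint nonempty skew diagrams with union $\tau$. A skew tableau $(\Gamma,\mathtt t)$ is a skew tiling with a bijection $\mathtt t:[1,|\Gamma|]\to\Gamma$ such that if $u\in\mathtt t(a)$, $v\in\mathtt t(b)$ lie in the same component and $u\searrow v$ then $a\le b$. A ribbon is a nonempty skew diagram in one component whose nodes can be listed so that each successive node is directly north or directly east of its predecessor. Given $\succeq$, a skew diagram $\tau$ with content $\omega\in\Phi_+$ is cuspidal if for every two-tile skew tableau $(\nu_1,\nu_2)$ of $\tau$, $\mathrm{cont}(\nu_1)$ is a sum of positive roots $\prec\omega$ and $\mathrm{cont}(\nu_2)$ is a sum of positive roots $\succ\omega$. A cuspidal Kostant tiling of $\tau$ is a skew tiling all of whose tiles are cuspidal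 ribbons, admitting an ordering $\mathtt t$ making it a skew tableau with $\mathrm{cont}(\mathtt t(a))\succeq\mathrm{cont}(\mathtt t(b))$ for $a\le b$. It is known that every skew diagram $\tau$ has a unique cuspidal Kostant tiling, denoted $\Gamma_\tau$. *)

(* Defs.v *)
From HB Require Import structures.
From mathcomp Require Import all_boot all_order all_algebra fingroup perm.
From mathcomp Require Export finmap.

Set Implicit Arguments.
Unset Strict Implicit.
Unset Printing Implicit Defensive.

Import Order.TTheory GRing.Theory Num.Theory.
Local Open Scope fset_scope.
Local Open Scope ring_scope.

(* ['Z_e] is Z/eZ only for [1 < e], a hypothesis to be added to every result
   that uses these definitions. *)

Notation rootlattice e := {ffun 'Z_e -> int}.

(* The value of [resid e t] in nat is the representative of t in [0, e-1]. *)
Definition resid (e : nat) (t : int) : 'Z_e := t%:~R.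

Definition simple (e : nat) (i : 'Z_e) : rootlattice e :=
  [ffun j => (j == i)%:R].

Definition nonneg (e : nat) (b : rootlattice e) : Prop := forall i, 0 <= b i.

Definition alpha (e : nat) (t : int) (L : nat) : rootlattice e :=
  \sum_(k < L) simple (resid e (t + k%:Z)).

Definition delta (e : nat) : rootlattice e := \sum_(i : 'Z_e) simple i.

Definition posroot (e : nat) (b : rootlattice e) : Prop :=
  exists (t : int) (L : nat), (1 <= L)%N /\ b = alpha e t L.

(* [R b c] reads "b succeeds or equals c".  Relations on positive roots are
   given as relations on the whole root lattice, of which only the values on
   pairs of positive roots matter. *)
Record convex_preorder (e : nat) (R : rootlattice e -> rootlattice e -> Prop) :
    Prop := ConvexPreorder {
  cvx_refl : forall b, posroot b -> R b b;
  cvx_trans : forall b c d, posroot b -> posroot c -> posroot d ->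
    R b c -> R c d -> R b d;
  cvx_total : forall b c, posroot b -> posroot c -> R b c \/ R c b;
  cvx_convex : forall b c, posroot b -> posroot c -> posroot (b + c) ->
    R b c -> R b (b + c) /\ R (b + c) c;
  cvx_equiv : forall b c, posroot b -> posroot c ->
    (R b c /\ R c b <->
     b = c \/ exists m n, [/\ (1 <= m)%N, (1 <= n)%N,
                              b = delta e *+ m & c = delta e *+ n])
}.

Definition strict (T : Type) (R : T -> T -> Prop) (b c : T) : Prop :=
  R b c /\ ~ R c b.

Definition sum_of_posroots (e : nat) (P : rootlattice e -> Prop)
    (b : rootlattice e) : Prop :=
  exists s : seq (rootlattice e),
    (forall c, c \in s -> posroot c /\ P c) /\ b = \sum_(c <- s) c.

(* (row, column) *)
Notation cell := (int * int)%type.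

(* A node of N_l: its component, and its position there. *)
Notation node l := ('I_l * (int * int))%type.

Definition southeast (u v : cell) : bool := (u.1 <= v.1) && (u.2 <= v.2).

Definition component (l : nat) (S : {fset node l}) (r : 'I_l) : {fset cell} :=
  [fset u.2 | u in S & u.1 == r].

Definition res_node (e l : nat) (u : node l) : 'Z_e := resid e (u.2.2 - u.2.1).

Definition content (e l : nat) (S : {fset node l}) : rootlattice e :=
  \sum_(u <- S) simple (res_node e u).

Definition skew_shape (S : {fset cell}) : Prop :=
  forall u v w, u \in S -> w \in S -> southeast u v -> southeast v w -> v \in S.

Definition skew (l : nat) (tau : {fset node l}) : Prop :=
  forall r, skew_shape (component tau r).

Definition is_partition (k : int) (la : {fset cell}) : Prop :=
  skew_shape la /\
  (la = fset0 \/
   (1, k + 1) \in la /\ forall u, u \in la -> southeast (1, k + 1) u).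

Definition row_length (la : {fset cell}) (a : nat) : nat :=
  #|` [fset u in la | u.1 == a%:Z] |.

Definition is_multipartition (l : nat) (kappa : 'I_l -> int)
    (la : {fset node l}) : Prop :=
  forall r, is_partition (kappa r) (component la r).

Definition beta_set (e l : nat) (kappa : 'I_l -> int) (la : {fset node l})
    (r : 'I_l) (x : int) : Prop :=
  exists a : nat, (1 <= a)%N /\
    x = (resid e (kappa r) : nat)%:Z
        + (row_length (component la r) a)%:Z - a%:Z.

(* The residue permutation (theta_1, ..., theta_e) is indexed from 0. *)
Definition RoCK (e l : nat) (kappa : 'I_l -> int) (theta : {perm 'I_e})
    (la : {fset node l}) : Prop :=
  forall (r : 'I_l) (x y : int) (a b : 'I_e),
    beta_set e kappa la r y -> ~ beta_set e kappa la r x -> x < y ->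
    resid e x = theta a :> nat -> resid e y = theta b :> nat -> (a <= b)%N.

Definition multicore (e l : nat) (kappa : 'I_l -> int)
    (la : {fset node l}) : Prop :=
  forall (r : 'I_l) (x : int),
    beta_set e kappa la r x -> beta_set e kappa la r (x - e%:Z).

Definition RoCK_block (e l : nat) (kappa : 'I_l -> int)
    (beta : rootlattice e) : Prop :=
  exists theta : {perm 'I_e}, forall la : {fset node l},
    is_multipartition kappa la -> content e la = beta -> RoCK kappa theta la.

Definition core_block (e l : nat) (kappa : 'I_l -> int)
    (beta : rootlattice e) : Prop :=
  forall la : {fset node l},
    is_multipartition kappa la -> content e la = beta -> multicore e kappa la.

Definition skew_tiling (l : nat) (tau : {fset node l})
    (G : {fset {fset node l}}) : Prop :=
  [/\ forall nu, nu \in G -> nu != fset0 /\ skew nu,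
      trivIfset G & fcover G = tau].

(* The bijection from [1, |G|] to G is given by the list of its values. *)
Definition skew_tableau (l : nat) (tau : {fset node l})
    (G : {fset {fset node l}}) (t : seq {fset node l}) : Prop :=
  [/\ skew_tiling tau G, perm_eq t G &
      forall (a b : nat) (u v : node l), (a < size t)%N -> (b < size t)%N ->
        u \in nth fset0 t a -> v \in nth fset0 t b ->
        u.1 = v.1 -> southeast u.2 v.2 -> (a <= b)%N].

Definition north_or_east (u v : cell) : bool :=
  (v == (u.1 - 1, u.2)) || (v == (u.1, u.2 + 1)).

Definition ribbon (l : nat) (xi : {fset node l}) : Prop :=
  [/\ xi != fset0, skew xi &
      exists (r : 'I_l) (s : seq cell),
        sorted north_or_east s /\ xi =i [seq (r, u) | u <- s]].

Definition cuspidal (e l : nat) (R : rootlattice e -> rootlattice e -> Prop)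
    (tau : {fset node l}) : Prop :=
  [/\ skew tau, posroot (content e tau) &
      forall nu1 nu2 : {fset node l},
        skew_tableau tau [fset nu1; nu2] [:: nu1; nu2] ->
        sum_of_posroots (fun c => strict R (content e tau) c) (content e nu1) /\
        sum_of_posroots (fun c => strict R c (content e tau)) (content e nu2)].

Definition cuspidal_Kostant_tiling (e l : nat)
    (R : rootlattice e -> rootlattice e -> Prop)
    (tau : {fset node l}) (G : {fset {fset node l}}) : Prop :=
  [/\ skew_tiling tau G,
      forall xi, xi \in G -> cuspidal R xi /\ ribbon xi &
      exists t : seq {fset node l}, skew_tableau tau G t /\
        forall a b : nat, (a <= b)%N -> (b < size t)%N ->
          R (content e (nth fset0 t a)) (content e (nth fset0 t b))].

(* "The cuspidal Kostant tiling of tau consists only of tiles whose content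
   satisfies P".  That tiling exists and is unique when R is a convex
   preorder. *)
Definition Kostant_tiles_satisfy (e l : nat)
    (R : rootlattice e -> rootlattice e -> Prop)
    (P : rootlattice e -> Prop) (tau : {fset node l}) : Prop :=
  exists G : {fset {fset node l}}, cuspidal_Kostant_tiling R tau G /\
    forall xi, xi \in G -> P (content e xi).

(* Main.v *)
Require Import Defs.
From HB Require Import structures.
From mathcomp Require Import all_boot all_order all_algebra fingroup perm finmap.
From mathcomp Require Import zify ring.
From Stdlib Require Import Classical_Prop.

(** Removing the rim hook of a partition that moves a bead from y down to a gap x removes the
    content [alpha(x+1, y-x)].  A multipartition is theta-RoCK (resp. also a multicore) exactly
    when x weakly (resp. strictly) precedes y in the order theta of the residues, for each of its
    removable rim hooks.

    A convex preorder induces a linear order on the residues, x preceding y when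
    [alpha(x+1, y-x)] succeeds delta, hence a linear form on the root lattice with the value
    [pos y - pos x] on [alpha(x+1, y-x)].  If all the tiles of a Kostant tiling succeed or equal
    delta then, by cuspidality, the form is nonnegative on the content of every southeast closed
    subset, in particular of every removable rim hook.

    Conversely an order on the residues yields a convex preorder: map the simple root of residue i
    to [X^(pos i) - X^(pos (i-1))] in [int[X]], ordered by leading coefficients, and compare the
    quotients by the height.  The removable rim hook of smallest quotient, and of smallest length
    among those, is cuspidal; removing such rim hooks repeatedly gives the Kostant tiling, each
    tile of which succeeds or equals some removable rim hook of the whole multipartition.

    In a core block the order comes from a potential b on the residues such that
    [y - b y <= x - b x] for all beads y and gaps x of a component.  It exists for one element of
    the block because a positive cycle of bead moves would produce, together with the addition of
    a rim hook of content k delta, an element of the block that is not a multicore; and it works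
    for the whole block because the sum of [z - b z] over the beads z depends only on the
    content. *)

Set Implicit Arguments.
Unset Strict Implicit.
Unset Printing Implicit Defensive.

Import Order.TTheory GRing.Theory Num.Theory.
Local Open Scope fset_scope.
Local Open Scope ring_scope.

(** * The root lattice *)

Section Roots.
Variables (e : nat) (he : (1 < e)%N).
Implicit Types (t x y z : int) (L n k : nat) (b c : rootlattice e).

Lemma residD t x : resid e (t + x) = resid e t + resid e x.
Proof. by rewrite /resid intrD. Qed.

Lemma resid_modz z : (resid e z : nat)%:Z = (z %% e)%Z.
Proof.
have e0 : (e : int) != 0 by lia.
have h : (z %% e)%Z = `|(z %% e)%Z|%N by have := modz_ge0 z e0; lia.
have ee : (e%:Z)%:~R = 0 :> 'Z_e.
  by rewrite -pmulrn; apply/val_inj; rewrite /= val_Zp_nat // modnn.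
rewrite /resid [in LHS](divz_eq z e) intrD intrM ee mulr0 add0r.
rewrite [in LHS]h -pmulrn val_Zp_nat // modn_small //.
by have := ltz_pmod z (_ : 0 < e%:Z); lia.
Qed.

Lemma eq_resid x y : resid e x = resid e y <-> exists k : int, y = x + k * e.
Proof.
split=> [xy|[k ->]]; last first.
  apply: val_inj; suff : (resid e (x + k * e) : nat)%:Z = (resid e x : nat)%:Z.
    by move=> /= [].
  by rewrite !resid_modz addrC modzMDl.
exists ((y %/ e)%Z - (x %/ e)%Z).
have := divz_eq x e; have := divz_eq y e.
rewrite -!resid_modz xy; lia.
Qed.

Lemma resid_nat (i : 'Z_e) : resid e (i : nat)%:Z = i.
Proof.
apply: val_inj; suff : (resid e (i : nat)%:Z : nat)%:Z = (i : nat)%:Z.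
  by move=> /= [].
rewrite resid_modz modz_small //=.
have := ltn_ord i; rewrite [X in (_ < X)%N -> _](Zp_cast he); lia.
Qed.

(* The summatory function of the simple roots: a root is the increment of [root_pot] between
   two integers, which turns every linear form on the root lattice into a telescoping sum. *)
Definition root_pot z : rootlattice e :=
  [ffun i : 'Z_e => ((z - (i : nat)%:Z) %/ e)%Z].

(** The floor of (z - i) / e jumps by one from z to z + 1 exactly when z + 1 has residue i. *)
Lemma root_potS z : root_pot (z + 1) = root_pot z + simple (resid e (z + 1)).
Proof.
apply/ffunP=> i; rewrite !ffunE.
have e0 : (0 < e%:Z) by lia.
have li : ((i : nat) < e)%N by have := ltn_ord i; rewrite [X in (_ < X)%N -> _](Zp_cast he).
have -> : (i == resid e (z + 1)) = ((i : nat)%:Z == ((z + 1) %% e)%Z).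
  by rewrite -resid_modz eqz_nat.
set q := ((z + 1) %/ e)%Z; set m := ((z + 1) %% e)%Z.
have zE : z + 1 = q * e + m by apply: divz_eq.
have m0 : 0 <= m by apply: modz_ge0; lia.
have me : m < e by apply: ltz_pmod.
have dv (a : int) (r : int) : 0 <= r -> r < e -> ((a * e%:Z + r) %/ e)%Z = a.
  by move=> r0 re; rewrite divzMDl ?divz_small ?addr0 //; lia.
case: eqP => [im|im].
  have -> : z + 1 - (i : nat)%:Z = q * e + 0 by lia.
  have -> : z - (i : nat)%:Z = (q - 1) * e + (e%:Z - 1) by lia.
  by rewrite !dv ?mulr1n; lia.
rewrite addr0; case: (ltrgtP (i : nat)%:Z m) im => // hm _.
  have -> : z + 1 - (i : nat)%:Z = q * e + (m - (i : nat)%:Z) by lia.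
  have -> : z - (i : nat)%:Z = q * e + (m - (i : nat)%:Z - 1) by lia.
  by rewrite !dv; lia.
have -> : z + 1 - (i : nat)%:Z = (q - 1) * e + (e%:Z + m - (i : nat)%:Z) by lia.
have -> : z - (i : nat)%:Z = (q - 1) * e + (e%:Z + m - (i : nat)%:Z - 1) by lia.
by rewrite !dv; lia.
Qed.

Lemma alpha0 t : alpha e t 0 = 0.
Proof. by rewrite /alpha big_ord0. Qed.

Lemma alphaS t L : alpha e t L.+1 = alpha e t L + simple (resid e (t + L)).
Proof. by rewrite /alpha big_ord_recr. Qed.

Lemma alphaE t L : alpha e (t + 1) L = root_pot (t + L) - root_pot t.
Proof.
elim: L => [|L IH]; first by rewrite alpha0 addr0 subrr.
have -> : t + L.+1 = t + L + 1 by lia.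
by rewrite alphaS IH root_potS addrAC; do 2 congr (_ + _); congr (simple (resid e _)); lia.
Qed.

Lemma alphaE' x y : x <= y -> alpha e (x + 1) `|y - x|%N = root_pot y - root_pot x.
Proof. by move=> xy; rewrite alphaE; congr (root_pot _ - _); lia. Qed.

Lemma root_potD z (k : int) : root_pot (z + k * e) = root_pot z + delta e *~ k.
Proof.
apply/ffunP=> i; rewrite !ffunE ffunMzE /delta sum_ffunE (bigD1 i) //= ffunE eqxx big1 => [|j ji].
  have -> : z + k * e - (i : nat)%:Z = k * e + (z - (i : nat)%:Z) by lia.
  by rewrite divzMDl ?addr0 ?intz 1?addrC //; lia.
by rewrite ffunE eq_sym (negPf ji).
Qed.

Lemma delta_root_pot z : delta e = root_pot (z + e) - root_pot z.
Proof. by rewrite -[e%:Z]mul1r root_potD mulr1z addrC addKr. Qed.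

Lemma posrootP b : posroot b <-> exists x y, x < y /\ b = root_pot y - root_pot x.
Proof.
split=> [[t [L [L0 ->]]]|[x [y [xy ->]]]].
  exists (t - 1), (t - 1 + L); split; first by lia.
  by rewrite -alphaE subrK.
by exists (x + 1), `|y - x|%N; split; [lia | rewrite alphaE' // ltW].
Qed.

Definition root_between x y : rootlattice e := root_pot y - root_pot x.

Lemma root_betweenD x y z : root_between x y + root_between y z = root_between x z.
Proof. by rewrite /root_between addrC addrA subrK. Qed.

Lemma posroot_root_between x y : x < y -> posroot (root_between x y).
Proof. by move=> xy; apply/posrootP; exists x, y. Qed.

Lemma root_pot_eq x y x' y' : resid e x = resid e x' -> y - x = y' - x' ->
  root_pot y - root_pot x = root_pot y' - root_pot x'.
Proof.
move=> /eq_resid[k ->] h; have -> : y' = y + k * e by lia.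
by rewrite !root_potD opprD addrACA subrr addr0.
Qed.

(** [Phi (root_pot z) - g z] does not change from z to z + 1, hence is constant; an additive map is
    thus computed on all roots from its values on the simple ones. *)
Lemma additive_root_pot (V : zmodType) (Phi : {additive rootlattice e -> V}) (g : int -> V) :
  (forall z, Phi (simple (resid e (z + 1))) = g (z + 1) - g z) ->
  forall x y, Phi (root_pot y - root_pot x) = g y - g x.
Proof.
move=> hg.
have step (z : int) : Phi (root_pot (z + 1)) - g (z + 1) = Phi (root_pot z) - g z.
  by rewrite root_potS raddfD /= hg addrA addrAC addrK.
have cst (z : int) : Phi (root_pot z) - g z = Phi (root_pot 0) - g 0.
  elim/int_rec: z => [//|n <-|n <-].
    by rewrite -(step n%:Z); have -> : n%:Z + 1 = n.+1%:Z by lia.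
  by rewrite -(step (- n.+1%:Z)); have -> : - n.+1%:Z + 1 = - n%:Z by lia.
move=> x y; rewrite raddfB /=.
have -> : Phi (root_pot x) = Phi (root_pot y) - g y + g x.
  by rewrite cst -(cst x) subrK.
by rewrite opprD opprB addrA addrCA subrr addr0.
Qed.

Definition height b : int := \sum_i b i.

Fact height_zmod_morphism : zmod_morphism height.
Proof. by move=> b c; rewrite /height -sumrB; apply: eq_bigr => i _; rewrite !ffunE. Qed.
HB.instance Definition _ := GRing.isZmodMorphism.Build _ _ height height_zmod_morphism.

Lemma height_simple i : height (simple i) = 1.
Proof.
by rewrite /height (bigD1 i) //= big1 ?ffunE ?eqxx ?addr0 // => j /negPf ji; rewrite ffunE ji.
Qed.

Lemma height_root x y : height (root_pot y - root_pot x) = y - x.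
Proof. by apply: (additive_root_pot (g := id)) => z; rewrite /= height_simple; lia. Qed.

Section Telescope.
Variables (V : zmodType) (h : 'Z_e -> V).

(** As the residues form a cycle, such a form kills delta; every linear form that kills delta arises
    in this way. *)
Definition telescope b : V := \sum_i (h i - h (i - 1)) *~ b i.

Fact telescope_zmod_morphism : zmod_morphism telescope.
Proof.
move=> b c; rewrite /telescope -sumrB; apply: eq_bigr => i _.
by rewrite !ffunE mulrzBr.
Qed.
HB.instance Definition _ := GRing.isZmodMorphism.Build _ _ telescope telescope_zmod_morphism.

Lemma telescope_simple i : telescope (simple i) = h i - h (i - 1).
Proof.
by rewrite /telescope (bigD1 i) //= big1 ?ffunE ?eqxx ?addr0 // => j /negPf ji; rewrite ffunE ji.
Qed.

Lemma telescope_root x y :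
  telescope (root_pot y - root_pot x) = h (resid e y) - h (resid e x).
Proof.
apply: (additive_root_pot (g := h \o resid e)) => z; rewrite /= telescope_simple.
by congr (_ - h _); rewrite residD addrK.
Qed.

End Telescope.

End Roots.

(** * The convex preorder of a linear order on residues *)

Section LeadCoef.
Variable R : realDomainType.
Implicit Types p q : {poly R}.

(** Closure under addition of the nonnegative cone of an order on polynomials. If the sizes agree,
    the two leading coefficients have the same sign and cannot cancel. *)
Lemma lead_coefD_ge0 p q :
  0 <= lead_coef p -> 0 <= lead_coef q -> 0 <= lead_coef (p + q).
Proof.
move=> p0 q0; case: (ltngtP (size p) (size q)) => [pq|qp|pq].
- by rewrite lead_coefDr.
- by rewrite lead_coefDl.
have [->|pn0] := eqVneq p 0; first by rewrite add0r.
have qn0 : q != 0 by rewrite -size_poly_eq0 -pq size_poly_eq0.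
have h : (p + q)`_(size p).-1 = lead_coef p + lead_coef q by rewrite coefD !lead_coefE pq.
have pq_gt0 : 0 < lead_coef p + lead_coef q.
  by rewrite ltr_wpDr // lt_def lead_coef_eq0 pn0.
suff -> : lead_coef (p + q) = lead_coef p + lead_coef q by exact: ltW.
suff s : size (p + q) = size p by rewrite lead_coefE s h.
apply/eqP; rewrite eqn_leq; apply/andP; split.
  by apply: (leq_trans (size_polyD _ _)); rewrite pq maxnn.
rewrite leqNgt; apply/negP => lt.
have : (p + q)`_(size p).-1 = 0.
  by apply: nth_default; move: lt; case: (size p).
by move=> h0; move: pq_gt0; rewrite -h h0 ltxx.
Qed.

Lemma lead_coefD_gt0 p q :
  0 <= lead_coef p -> 0 < lead_coef q -> 0 < lead_coef (p + q).
Proof.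
move=> p0 q0; rewrite lt_def lead_coefD_ge0 ?(ltW q0) // andbT lead_coef_eq0.
apply/eqP => /eqP; rewrite addrC addr_eq0 => /eqP qE.
by move: q0; rewrite qE lead_coefN oppr_gt0 ltNge p0.
Qed.

Lemma lead_coef_eq0_sgn p : 0 <= lead_coef p -> 0 <= lead_coef (- p) -> p = 0.
Proof.
rewrite lead_coefN oppr_ge0 => p0 p1.
by apply/eqP; rewrite -lead_coef_eq0; apply/eqP/le_anti; rewrite p0 p1.
Qed.

End LeadCoef.

Section Slope.
Variables (e : nat) (he : (1 < e)%N) (pos : 'Z_e -> nat).
Hypothesis pos_inj : injective pos.
Implicit Types b c d : rootlattice e.

Definition charge : rootlattice e -> {poly int} := telescope (fun i => 'X^(pos i)).

(* The sign of [charge b / height b - charge c / height c], the polynomial ring being ordered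
   by the signs of leading coefficients. *)
Definition slope_cmp c b : {poly int} := height c *: charge b - height b *: charge c.

Definition slope_ge b c : Prop := 0 <= lead_coef (slope_cmp c b).

Fact slope_cmp_zmod_morphism c : zmod_morphism (slope_cmp c).
Proof.
move=> b b'; rewrite /slope_cmp /charge !raddfB /= scalerBl.
by rewrite !opprD !opprK addrACA.
Qed.
HB.instance Definition _ c :=
  GRing.isZmodMorphism.Build _ _ (slope_cmp c) (slope_cmp_zmod_morphism c).

Lemma slope_cmpD c b b' : slope_cmp c (b + b') = slope_cmp c b + slope_cmp c b'.
Proof. exact: raddfD. Qed.

Lemma slope_cmpxx b : slope_cmp b b = 0.
Proof. by rewrite /slope_cmp subrr. Qed.

Lemma slope_cmpC b c : slope_cmp b c = - slope_cmp c b.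
Proof. by rewrite /slope_cmp opprB. Qed.

Lemma charge_root x y :
  charge (root_pot e y - root_pot e x) = 'X^(pos (resid e y)) - 'X^(pos (resid e x)).
Proof. exact: telescope_root. Qed.

Lemma posroot_height_gt0 b : posroot b -> 0 < height b.
Proof.
move=> /(posrootP he)[x [y [xy ->]]]; rewrite height_root //; lia.
Qed.

(** Multiplied by the height of the middle element, the comparison of b with d is a combination of
    the other two comparisons with positive coefficients. *)
Lemma slope_ge_trans b c d : 0 < height b -> 0 < height c -> 0 < height d ->
  slope_ge b c -> slope_ge c d -> slope_ge b d.
Proof.
move=> b0 c0 d0 bc cd; rewrite /slope_ge.
rewrite -(pmulr_rge0 _ c0) -lead_coefZ.
have -> : height c *: slope_cmp d b = height d *: slope_cmp c b + height b *: slope_cmp d c.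
  rewrite /slope_cmp !scalerBr !scalerA addrA.
  rewrite [height b * height d]mulrC [height d * height b]mulrC subrK; congr (_ *: _ - _ *: _).
    exact: mulrC.
  exact: mulrC.
by apply: lead_coefD_ge0; rewrite lead_coefZ pmulr_rge0.
Qed.

(** With t the indeterminate, the equation reads [(y' - x') (t^Y - t^X) = (y - x) (t^Y' - t^X')]
    with positive factors. If X and Y differ, comparing coefficients forces the same exponents with
    the same signs, then the same height; if they agree, both sides vanish. *)
Lemma slope_cmp_eq0 b c : posroot b -> posroot c -> slope_cmp c b = 0 ->
  b = c \/ charge b = 0 /\ charge c = 0.
Proof.
move=> hb hc; have b0 := posroot_height_gt0 hb; have c0 := posroot_height_gt0 hc.
move: hb b0 hc c0 => /(posrootP he)[x [y [xy ->]]] + /(posrootP he)[x' [y' [xy' ->]]].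
rewrite /slope_cmp !height_root // !charge_root => b0 c0 /eqP.
rewrite subr_eq0 => /eqP E.
set X := pos (resid e x) in E; set Y := pos (resid e y) in E.
set X' := pos (resid e x') in E; set Y' := pos (resid e y') in E.
have co k := congr1 (fun p : {poly int} => p`_k) E.
have {}co k : (y' - x') * ((k == Y)%:R - (k == X)%:R) = (y - x) * ((k == Y')%:R - (k == X')%:R).
  by have := co k; rewrite !coefZ !coefB !coefXn.
case: (eqVneq X Y) => [XY|XY].
  right; rewrite -/X -/Y -/X' -/Y' XY subrr; split=> //.
  have := co Y'; rewrite XY subrr mulr0 eqxx => /esym/eqP.
  rewrite mulf_eq0 (gt_eqF b0) /= subr_eq0.
  by case: (eqVneq Y' X') => [->|]; rewrite ?subrr //= oner_eq0.
left.
have YY' : Y = Y'.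
  apply/eqP; have := co Y; rewrite eqxx eq_sym (negPf XY) subr0 mulr1.
  by case: eqP => // _; case: eqP => _; rewrite ?subrr ?subr0 ?sub0r ?mulr0 ?mulrN1; lia.
have XX' : X = X'.
  apply/eqP; have := co X; rewrite eqxx (negPf XY) sub0r mulrN1.
  by case: (X == X') => //; case: eqP => _; rewrite ?subrr ?subr0 ?sub0r ?mulr0 ?mulr1; lia.
have L : y' - x' = y - x.
  by have := co Y; rewrite -YY' -XX' eqxx eq_sym (negPf XY) subr0 !mulr1.
by apply: root_pot_eq => //; apply: pos_inj.
Qed.

Lemma charge_eq0 x y : charge (root_pot e y - root_pot e x) = 0 -> resid e x = resid e y.
Proof.
rewrite charge_root => /eqP; rewrite subr_eq0 => /eqP /(congr1 (fun p : {poly int} => size p)).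
by rewrite !size_polyXn => -[] /pos_inj.
Qed.

Lemma charge_delta : charge (delta e) = 0.
Proof.
rewrite (delta_root_pot he 0) charge_root.
suff -> : resid e (0 + e) = resid e 0 by rewrite subrr.
by apply/esym/(eq_resid he); exists 1; rewrite mul1r.
Qed.

(** Since delta has charge 0, the sign is that of the term with the larger exponent in the charge of
    the root. *)
Lemma slope_ge_delta x y : slope_ge (root_pot e y - root_pot e x) (delta e) <->
  (pos (resid e x) <= pos (resid e y))%N.
Proof.
rewrite /slope_ge /slope_cmp charge_delta scaler0 subr0 (delta_root_pot he 0) height_root //.
rewrite lead_coefZ add0r subr0 pmulr_rge0; last by lia.
rewrite charge_root; case: ltngtP => [lt|lt|->].
- by rewrite lead_coefDl ?lead_coefXn // size_polyN !size_polyXn.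
- rewrite lead_coefDr ?lead_coefN ?lead_coefXn ?size_polyN ?size_polyXn //.
- by rewrite subrr lead_coef0.
Qed.

Lemma slope_gt_delta x y : (pos (resid e x) < pos (resid e y))%N ->
  strict slope_ge (root_pot e y - root_pot e x) (delta e).
Proof.
move=> lt; split; first by apply/slope_ge_delta/ltnW.
rewrite /slope_ge /slope_cmp charge_delta scaler0 sub0r (delta_root_pot he 0) height_root //.
rewrite lead_coefN lead_coefZ charge_root lead_coefDl ?lead_coefXn ?size_polyN ?size_polyXn //; lia.
Qed.

(** Convexity is the mediant property of quotients: by additivity, comparing b + c with a summand
    amounts to comparing b with c. Ties between distinct roots have charge 0, that is equal end
    residues, so they are multiples of delta. *)
Lemma slope_convex_preorder : convex_preorder slope_ge.
Proof.
split.
- by move=> b _; rewrite /slope_ge slope_cmpxx lead_coef0.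
- move=> b c d /posroot_height_gt0 b0 /posroot_height_gt0 c0 /posroot_height_gt0.
  exact: slope_ge_trans.
- move=> b c _ _; rewrite /slope_ge (slope_cmpC b c) lead_coefN oppr_ge0.
  by apply/orP; apply: le_total.
- move=> b c _ _ _ bc; split; rewrite /slope_ge.
    by rewrite slope_cmpC slope_cmpD slope_cmpxx add0r -slope_cmpC.
  by rewrite slope_cmpD slope_cmpxx addr0.
move=> b c hb hc; split=> [[bc cb]|].
  have D0 : slope_cmp c b = 0 by apply: lead_coef_eq0_sgn; rewrite // -slope_cmpC.
  have [->|[Pb Pc]] := slope_cmp_eq0 hb hc D0; [by left | right].
  have im d : posroot d -> charge d = 0 -> exists2 m : nat, (1 <= m)%N & d = delta e *+ m.
    move=> /(posrootP he)[x [y [xy ->]]] /charge_eq0 /(eq_resid he)[k yE].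
    exists `|k|%N; first by nia.
    rewrite yE root_potD // addrC addKr pmulrn; congr (_ *~ _); nia.
  by have [m ? ?] := im b hb Pb; have [n ? ?] := im c hc Pc; exists m, n.
case=> [->|[m [n [m1 n1 -> ->]]]]; first by rewrite /slope_ge slope_cmpxx lead_coef0.
have cM k : charge (delta e *+ k) = 0.
  have := raddfMn (telescope (fun i => 'X^(pos i) : {poly int})) k (delta e).
  by move=> /= h; rewrite /charge h -/(charge _) charge_delta mul0rn.
by rewrite /slope_ge /slope_cmp !cM !scaler0 subrr lead_coef0.
Qed.

End Slope.

(** * Beads *)

(* [N z] is the row of the last node of content z of a partition of charge k, extended to the
   diagonals that miss the partition; it determines the partition. *)
Definition profile (M : nat) (k : int) (N : int -> int) : Prop :=
  (forall z, N (z + 1) = N z \/ N (z + 1) = N z - 1) /\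
  (forall z, (M%:Z <= z -> N z = 0) /\ (z <= - M%:Z -> N z = k - z)).

(* The beads are the elements of the beta set, normalised by the charge itself and not by its
   residue in [0, e-1]. *)
Definition bead (N : int -> int) (z : int) : bool := N (z + 1) == N z - 1.

(* The profile after the bead at y has been moved to x (to the left or to the right). *)
Definition move (N : int -> int) (y x z : int) : int :=
  N z - (if x < z <= y then 1 else 0) + (if y < z <= x then 1 else 0).

Section Profile.
Variables (M : nat) (k : int) (N : int -> int).
Hypothesis prN : profile M k N.
Implicit Types x y z : int.

Lemma bead_succ z : bead N z -> N (z + 1) = N z - 1.
Proof. by move/eqP. Qed.

Lemma nbead_succ z : ~~ bead N z -> N (z + 1) = N z.
Proof. by case: prN => st _; rewrite /bead; case: (st z) => // ->; rewrite eqxx. Qed.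

Lemma profile_mono x y : x <= y -> N y <= N x /\ N x + x <= N y + y.
Proof.
move=> xy; have -> : y = x + `|y - x|%N by lia.
elim: `|y - x|%N => [|n [IH1 IH2]]; first by rewrite addr0.
case: prN => st _; have := st (x + n); have -> : x + n.+1 = x + n + 1 by lia.
by case=> ->; lia.
Qed.

(** [N z] is nonincreasing and [N z + z] nondecreasing; each is compared with its value outside the
    window, where it is known. *)
Lemma profile_bounds z : 0 <= N z /\ k <= N z + z.
Proof.
case: prN => _ bd; split.
  have := profile_mono (_ : z <= Num.max z M).
  rewrite le_max lexx => /(_ isT)[+ _]; rewrite (bd _).1 // le_max lexx orbT //.
have := profile_mono (_ : Num.min z (- M%:Z) <= z).
rewrite ge_min lexx => /(_ isT)[_]; rewrite (bd _).2 ?ge_min ?lexx ?orbT //; lia.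
Qed.

Lemma profile_weaken M' : (M <= M')%N -> profile M' k N.
Proof.
by case: prN => st bd MM; split=> // z; split=> h; [apply: (bd z).1 | apply: (bd z).2]; lia.
Qed.

Lemma bead_low z : z < - M%:Z -> bead N z.
Proof. by case: prN => _ bd h; apply/eqP; rewrite !(bd _).2; lia. Qed.

Lemma bead_high z : bead N z -> z < M.
Proof.
case: prN => _ bd bz; rewrite ltNge; apply/negP => h.
by have := bead_succ bz; rewrite !(bd _).1; lia.
Qed.

Lemma nbead_high z : M%:Z <= z -> ~~ bead N z.
Proof. by move=> h; apply/negP => /bead_high; lia. Qed.

Lemma nbead_low z : ~~ bead N z -> - M%:Z <= z.
Proof. by move=> nb; rewrite leNgt; apply: contra nb; apply: bead_low. Qed.

Lemma bead_move y x z : x != y -> bead N y -> ~~ bead N x ->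
  bead (move N y x) z = (z == x) || (bead N z && (z != y)).
Proof.
move=> xy /bead_succ Ny Nx; have := nbead_succ Nx.
have := prN.1 z.
rewrite /bead /move; case: (eqVneq z x) => [->|zx] /=.
  by move=> _ Nx1; apply/eqP; rewrite Nx1; do 4 case: ifP; lia.
case: (eqVneq z y) => [->|zy] /=.
  by move=> _ _; rewrite andbF; apply/eqP; rewrite Ny; do 4 case: ifP; lia.
move=> _ _; rewrite andbT.
by apply/eqP/eqP; do 4 case: ifP; lia.
Qed.

Lemma profile_move y x M' : x != y -> bead N y -> ~~ bead N x ->
  (M <= M')%N -> x < M'%:Z -> - M'%:Z <= y -> profile M' k (move N y x).
Proof.
move=> xy by_ bx MM xM yM.
have [yM' xM'] := (bead_high by_, nbead_low bx).
split=> [z|z].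
  have Ny := bead_succ by_; have Nx := nbead_succ bx; rewrite /move.
  case: (eqVneq z x) => [->|zx]; first by right; rewrite Nx; do 4 case: ifP; lia.
  case: (eqVneq z y) => [->|zy]; first by left; rewrite Ny; do 4 case: ifP; lia.
  by case: (prN.1 z) => ->; [left | right]; do 4 case: ifP; lia.
have [bd1 bd2] := prN.2 z.
by rewrite /move; split=> h; [rewrite bd1 | rewrite bd2]; try (do 2 case: ifP); lia.
Qed.

End Profile.

(** A multipartition described diagonal by diagonal, c - a being the diagonal of the node (a, c).
    Outside the window given by [M] the profiles are those of the empty partition. *)
Definition represents (l : nat) (kappa : 'I_l -> int) (M : nat) (N : 'I_l -> int -> int)
    (la : {fset node l}) : Prop :=
  (forall r, profile M (kappa r) (N r)) /\
  (forall r a c, ((r, (a, c)) \in la) = [&& 1 <= a, a <= N r (c - a) & kappa r + 1 <= c]).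

(** * Multipartitions as families of profiles *)

Section Represent.
Variables (l : nat) (kappa : 'I_l -> int).
Implicit Types (la mu S : {fset node l}) (r : 'I_l) (N : 'I_l -> int -> int) (x y z : int).

Lemma in_component S r (u : cell) : (u \in component S r) = ((r, u) \in S).
Proof.
apply/imfsetP/idP => /= [[[r' v]]|h]; last by exists (r, u); rewrite // inE h /=.
by rewrite inE /= => /andP[h /eqP <-] ->.
Qed.

Lemma fset_node_bounded la : exists M : nat,
  forall r a c, (r, (a, c)) \in la -> `|a| <= M /\ `|c| <= M.
Proof.
exists (\max_(u <- la) (`|u.2.1| + `|u.2.2|)%N)%N => r a c h.
have := @leq_bigmax_seq _ (enum_fset la) predT (fun u => (`|u.2.1| + `|u.2.2|)%N) _ h isT.
move=> /=; lia.
Qed.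

Lemma multipartition_represents la : is_multipartition kappa la ->
  exists M N, represents kappa M N la.
Proof.
move=> mp.
have sk r a c a' c' : (r, (a, c)) \in la -> 1 <= a' -> kappa r + 1 <= c' -> a' <= a -> c' <= c ->
    (r, (a', c')) \in la.
  move=> h a1 c1 aa cc; have [sk [h0|[h1 _]]] := mp r.
    by move: h; rewrite -in_component h0.
  rewrite -in_component; apply: (sk (1, kappa r + 1) _ (a, c)) => //; first by rewrite in_component.
    by rewrite /southeast a1.
  by rewrite /southeast /= aa.
have lb r a c : (r, (a, c)) \in la -> 1 <= a /\ kappa r + 1 <= c.
  move=> h; have [_ [h0|[_ h1]]] := mp r; first by move: h; rewrite -in_component h0.
  by move: h; rewrite -in_component => /h1 /andP[].
have [B hB] := fset_node_bounded la.
(* The node tested is in row n + 1 of diagonal z; the bound [kappa r - z <= n] keeps it in a column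
   at least [kappa r + 1]. *)
have ex r z : exists n : nat, (kappa r - z <= n) && ((r, (n%:Z + 1, n%:Z + 1 + z)) \notin la).
  exists (B + `|kappa r - z|)%N; apply/andP; split; first by lia.
  by apply/negP => /hB; lia.
pose N r z : int := (ex_minn (ex r z))%:Z.
have NP r z a : 1 <= a -> kappa r - z + 1 <= a -> ((r, (a, a + z)) \in la) = (a <= N r z).
  move=> a1 ka; rewrite /N; case: ex_minnP => n /andP[kn nla] nmin; apply/idP/idP => h.
    rewrite leNgt; apply/negP => na; move/negP: nla; apply.
    by apply: (sk _ _ _ _ _ h); lia.
  apply/negPn/negP => nh; have := nmin `|a - 1|%N.
  have -> : (`|a - 1|%N : int) = a - 1 by lia.
  by rewrite subrK nh andbT; lia.
have N0 r z : 0 <= N r z /\ kappa r - z <= N r z.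
  by rewrite /N; case: ex_minnP => n /andP[kn _] _; lia.
have mem r a c : ((r, (a, c)) \in la) = [&& 1 <= a, a <= N r (c - a) & kappa r + 1 <= c].
  case: (lerP 1 a) => a1 /=; last by apply/negP => /lb; lia.
  case: (lerP (kappa r + 1) c) => c1; last by rewrite andbF; apply/negP => /lb; lia.
  by rewrite andbT -NP //; [rewrite addrC subrK | lia].
exists (B + \max_r `|kappa r|)%N, N; split=> // r; split=> z.
  have [A1 A2] := N0 r z; have [B1 B2] := N0 r (z + 1).
  (* A rise of [N], or a drop by more than one, would give a node whose west, respectively north,
     neighbour is missing. *)
  have [lt|le] := ltrP (N r z) (N r (z + 1)).
    have : (r, (N r z + 1, N r z + 1 + (z + 1))) \in la by rewrite NP; lia.
    move=> /(sk _ _ _ (N r z + 1) (N r z + 1 + z)); rewrite NP; lia.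
  have [lt|] := ltrP (N r (z + 1)) (N r z - 1); last by lia.
  have : (r, (N r (z + 1) + 2, N r (z + 1) + 2 + z)) \in la by rewrite NP; lia.
  move=> /(sk _ _ _ (N r (z + 1) + 1) (N r (z + 1) + 1 + (z + 1))).
  rewrite NP; lia.
have kB : (`|kappa r| <= \max_r `|kappa r|)%N by apply: leq_bigmax.
have [A1 A2] := N0 r z; split=> h; apply/eqP; rewrite eq_le; apply/andP; split; try lia.
  rewrite leNgt; apply/negP => lt.
  have : (r, (N r z, N r z + z)) \in la by rewrite NP; lia.
  by move/hB; lia.
rewrite leNgt; apply/negP => lt.
have : (r, (N r z, N r z + z)) \in la by rewrite NP; lia.
by move=> /[dup] /lb ? /hB; lia.
Qed.

Lemma represents_multipartition M N la : represents kappa M N la -> is_multipartition kappa la.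
Proof.
move=> [pr mem] r; split.
  move=> [a c] [a1 c1] [a2 c2]; rewrite !in_component !mem /southeast /=.
  move=> /and3P[h1 h2 h3] /and3P[h4 h5 h6] /andP[h7 h8] /andP[h9 h10].
  apply/and3P; split; try lia.
  have [?|?] := lerP (c1 - a1) (c2 - a2).
    have := profile_mono (pr r) (_ : c1 - a1 <= c2 - a2); lia.
  have := profile_mono (pr r) (_ : c2 - a2 <= c1 - a1); lia.
case: (boolP ((1, kappa r + 1) \in component la r)) => [h|n]; [right | left].
  split=> // -[a c]; rewrite in_component mem /southeast /=; lia.
move: n; rewrite in_component mem /= => n.
apply/fsetP => -[a c]; rewrite in_component mem in_fset0; apply/negP => /and3P[h1 h2 h3].
move/negP: n; apply; rewrite lexx andbT addrK.
have [?|?] := lerP (c - a) (kappa r).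
  have := profile_mono (pr r) (_ : c - a <= kappa r); lia.
have := profile_mono (pr r) (_ : kappa r <= c - a); lia.
Qed.

Lemma profile_represents M N : (forall r, profile M (kappa r) (N r)) ->
  exists la, represents kappa M N la.
Proof.
move=> pr.
pose m (u : node l) := [&& 1 <= u.2.1, u.2.1 <= N u.1 (u.2.2 - u.2.1) & kappa u.1 + 1 <= u.2.2].
pose B : nat := (M + \max_r `|kappa r|)%N.
(* Nodes are enumerated by their row and their diagonal, the latter shifted by [B] to be a natural
   number. *)
pose f (p : 'I_l * ('I_(B + B).+1 * 'I_(B + B).+1)) : node l :=
  (p.1, ((p.2.1 : nat)%:Z, (p.2.2 : nat)%:Z + (p.2.1 : nat)%:Z - B%:Z)).
exists [fset f p | p in [pred p | m (f p)]]; split=> // r a c.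
apply/imfsetP/idP => /= [[p mp pE]|h].
  by have : m (f p) by []; rewrite -pE /m.
have [h1 h2 h3] := and3P h.
have kB : (`|kappa r| <= \max_r `|kappa r|)%N by apply: leq_bigmax.
have [b1 b2] := (pr r).2 (c - a).
have zlo : - M%:Z < c - a by rewrite ltNge; apply/negP => hh; move: h2; rewrite b2 //; lia.
have zhi : c - a < M by rewrite ltNge; apply/negP => hh; move: h2; rewrite b1 //; lia.
have lo : N r (c - a) <= N r (- M%:Z) by apply: (profile_mono (pr r) _).1; lia.
have := ((pr r).2 (- M%:Z)).2 (lexx _) => loE.
have ha : (`|a| < (B + B).+1)%N by rewrite /B; lia.
have hc : (`|(c - a + B)%R| < (B + B).+1)%N by rewrite /B; lia.
have E : (r, (a, c)) = f (r, (Ordinal ha, Ordinal hc)).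
  by rewrite /f /=; congr (_, (_, _)); lia.
by exists (r, (Ordinal ha, Ordinal hc)) => //; rewrite -topredE /= -E.
Qed.

End Represent.

(** [N] comes down to 0 from arbitrarily large values in steps of at most one, so at the last z with
    [a <= N z] it equals a and is about to drop. *)
Lemma bead_at_height M k N a : profile M k N -> 1 <= a -> exists2 z, bead N z & N z = a.
Proof.
move=> pr a1; pose K : nat := (M + `|k| + `|a|)%N.
have ex0 : exists n : nat, a <= N (- K%:Z + n).
  by exists 0%N; rewrite addr0 (pr.2 _).2 /K; lia.
have bd n : a <= N (- K%:Z + n%:Z) -> (n <= K + M)%N.
  by rewrite leqNgt => h; apply/negP => hn; move: h; rewrite (pr.2 _).1; lia.
case: (ex_maxnP ex0 bd) => n hn nmax; exists (- K%:Z + n); last first.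
  apply/eqP; rewrite eq_le hn andbT leNgt; apply/negP => lt.
  suff : (n < n)%N by lia.
  apply: nmax; have -> : - K%:Z + n.+1 = - K%:Z + n + 1 by lia.
  by case: (pr.1 (- K%:Z + n)) => ->; lia.
apply/negPn/negP => nb; suff : (n < n)%N by lia.
apply: nmax; have -> : - K%:Z + n.+1 = - K%:Z + n + 1 by lia.
by rewrite (nbead_succ pr nb).
Qed.

(** * Rim hooks and bead moves *)

Section Rim.
Variables (l : nat) (kappa : 'I_l -> int) (M : nat) (N : 'I_l -> int -> int) (la : {fset node l}).
Hypothesis repr : represents kappa M N la.
Implicit Types (r : 'I_l) (x y z : int).

(** Row [N r z] ends on the diagonal z of the bead, in column z + [N r z], because the next diagonal
    stops one row higher. *)
Lemma row_length_bead r z : bead (N r) z ->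
  (row_length (component la r) `|N r z|%N)%:Z = z + N r z - kappa r /\ 1 <= N r z.
Proof.
move=> bz; have [pr mem] := repr; have := bead_succ bz.
have [n1 _] := profile_bounds (pr r) (z + 1); have [_ n2] := profile_bounds (pr r) z => E.
have N1 : 1 <= N r z by lia.
split=> //; pose n := `|(z + N r z - kappa r)%R|%N.
suff -> : row_length (component la r) `|N r z|%N = n by rewrite /n; lia.
pose f (i : 'I_n) : cell := (N r z, kappa r + 1 + (i : nat)%:Z).
have inj : injective f.
  by move=> i j [] ij; apply: val_inj => /=; lia.
rewrite -[RHS]card_ord /row_length.
transitivity #|` [fset f i | i in 'I_n]|; last first.
  by rewrite card_imfset //= -cardE.
congr (#|` _|); apply/fsetP => -[a c]; apply/idP/imfsetP => /= [|[i _ ->]].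
  rewrite !inE /= in_component mem => /andP[h /eqP aE].
  have {}aE : a = N r z by lia.
  have cz : c - a <= z.
    rewrite leNgt; apply/negP => lt.
    by have := profile_mono (pr r) (_ : z + 1 <= c - a); lia.
  have hi : (`|(c - kappa r - 1)%R| < n)%N by rewrite /n; lia.
  by exists (Ordinal hi) => //=; rewrite /f /= aE; congr (_, _); lia.
rewrite !inE /= in_component mem; have := ltn_ord i; rewrite {2}/n => ltn.
have := profile_mono (pr r) (_ : kappa r + 1 + (i : nat)%:Z - N r z <= z); lia.
Qed.

Lemma beta_set_bead e r x :
  beta_set e kappa la r x <-> bead (N r) (x - (resid e (kappa r) : nat)%:Z + kappa r).
Proof.
have [pr mem] := repr; set z := (z in bead _ z); split=> [[a [a1 xE]]|bz].
  have {}a1 : 1 <= a%:Z by lia.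
  have [z' bz' Na] := bead_at_height (pr r) a1.
  have [] := row_length_bead bz'; rewrite Na absz_nat => rl _.
  by have -> : z = z' by rewrite /z; lia.
have [rl N1] := row_length_bead bz.
exists `|N r z|%N; split; first by lia.
have zE : z = x - (resid e (kappa r) : nat)%:Z + kappa r by [].
by rewrite rl; clearbody z; lia.
Qed.

Definition rim_node r z : node l := (r, (N r z, N r z + z)).

Lemma rim_node_inj r : injective (rim_node r).
Proof. by move=> z z' []; lia. Qed.

Definition rim_seq r x y : seq (node l) :=
  [seq rim_node r (x + 1 + n%:Z) | n <- iota 0 `|y - x|%N].

Lemma rim_seqP r x y z : x <= y -> (rim_node r z \in rim_seq r x y) = (x < z <= y).
Proof.
move=> xy; apply/mapP/idP => [[n + /rim_node_inj ->]|h].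
  by rewrite mem_iota; lia.
by exists `|(z - x - 1)%R|%N; [rewrite mem_iota; lia | congr (rim_node r _); lia].
Qed.

Lemma rim_seq_uniq r x y : uniq (rim_seq r x y).
Proof. by rewrite map_inj_uniq ?iota_uniq // => i j /rim_node_inj; lia. Qed.

(* The rim hook whose removal moves the bead at y down to the gap at x. *)
Definition rim r x y : {fset node l} := [fset u in rim_seq r x y].

Lemma mem_rim r x y u : (u \in rim r x y) = (u \in rim_seq r x y).
Proof. by rewrite inE. Qed.

Lemma rimP r x y u : x <= y ->
  u \in rim r x y <-> exists2 z, x < z <= y & u = rim_node r z.
Proof.
move=> xy; rewrite mem_rim; split=> [/mapP[n + ->]|[z xzy ->]]; last by rewrite rim_seqP.
by rewrite mem_iota => hn; exists (x + 1 + n%:Z) => //; lia.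
Qed.

Lemma rim_node_mem r x y z : x < y -> bead (N r) y -> ~~ bead (N r) x -> x < z <= y ->
  rim_node r z \in la.
Proof.
move=> xy by_ bx xzy; have [pr mem] := repr.
have := bead_succ by_; have := nbead_succ (pr r) bx.
have := profile_bounds (pr r) x; have := profile_bounds (pr r) (y + 1).
have := profile_mono (pr r) (_ : z <= y); have := profile_mono (pr r) (_ : x + 1 <= z).
have E : N r z + z - N r z = z by lia.
by rewrite mem E; lia.
Qed.

Definition move_family r y x (s : 'I_l) : int -> int := if s == r then move (N r) y x else N s.

Lemma move_family_profile r x y M' : x != y -> bead (N r) y -> ~~ bead (N r) x ->
  (M <= M')%N -> x < M'%:Z -> - M'%:Z <= y ->
  forall s, profile M' (kappa s) (move_family r y x s).
Proof.
move=> xy by_ bx MM xM yM s; rewrite /move_family; have [pr _] := repr.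
case: eqP => [->|_]; first exact: (profile_move (pr r)).
exact: (profile_weaken (pr s) MM).
Qed.

(** The move lowers the profile by one on the diagonals z with x < z <= y, so each of these loses
    exactly its last node. *)
Lemma rim_removal r x y : x < y -> bead (N r) y -> ~~ bead (N r) x ->
  rim r x y `<=` la /\ represents kappa M (move_family r y x) (la `\` rim r x y).
Proof.
move=> xy by_ bx; have [pr mem] := repr; split.
  by apply/fsubsetP => u /(rimP _ _ (ltW xy))[z xzy ->]; apply: rim_node_mem xzy.
split.
  have := bead_high (pr r) by_; have := nbead_low (pr r) bx => ? ?.
  by apply: move_family_profile => //; rewrite ?lt_eqF //; lia.
move=> s a c; rewrite inE mem mem_rim /move_family; case: (eqVneq s r) => [->|sr]; last first.
  case: (boolP (_ \in rim_seq _ _ _)) => // /mapP[n _ [sr']]; by rewrite sr' eqxx in sr.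
have E : ((r, (a, c)) \in rim_seq r x y) = (x < c - a <= y) && (a == N r (c - a)).
  apply/idP/andP => [|[h /eqP aE]].
    rewrite -mem_rim => /(rimP _ _ (ltW xy))[z xzy [-> ->]].
    have -> : N r z + z - N r z = z by lia.
    by rewrite xzy.
  rewrite (_ : (r, (a, c)) = rim_node r (c - a)) ?rim_seqP ?(ltW xy) //.
  by congr (_, (_, _)); lia.
rewrite {}E /move; have -> : (y < c - a <= x) = false by lia.
have := bead_succ by_; have := profile_mono (pr r) (_ : c - a <= y).
have := profile_bounds (pr r) (y + 1).
case: (x < c - a <= y) => /=; last by rewrite subr0 addr0.
by lia.
Qed.

Lemma content_sub_rim e r x y (nu : {fset node l}) : nu `<=` rim r x y ->
  content e nu =
    \sum_(n < `|y - x|%N | rim_node r (x + 1 + n%:Z) \in nu) simple (resid e (x + 1 + n%:Z)).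
Proof.
move=> sub; rewrite /content.
transitivity (\sum_(u <- rim_seq r x y | u \in nu) simple (res_node e u)).
  rewrite -[RHS]big_filter; apply: perm_big; apply: uniq_perm.
  - exact: fset_uniq.
  - exact/filter_uniq/rim_seq_uniq.
  by move=> u; rewrite mem_filter andb_idr // => /(fsubsetP sub); rewrite mem_rim.
rewrite big_map (_ : iota 0 _ = index_iota 0 `|y - x|%N) ?big_mkord; last first.
  by rewrite /index_iota subn0.
apply: eq_bigr => n _.
by rewrite /res_node /=; congr (simple (resid e _)); lia.
Qed.

Lemma content_rim e r x y : content e (rim r x y) = alpha e (x + 1) `|y - x|%N.
Proof.
rewrite (@content_sub_rim e r x y) // /alpha; apply: eq_bigl => n.
rewrite mem_rim; apply/mapP; exists (n : nat) => //; rewrite mem_iota; have := ltn_ord n; lia.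
Qed.

End Rim.

(** * Removable rim hooks *)

(* [lia] preceded by the removal of the hypotheses that are not integer comparisons: it is
   exponential in the number of opaque boolean hypotheses. *)
Ltac ilia :=
  repeat match goal with H : is_true ?b |- _ =>
    lazymatch b with
    | Order.le _ _ => fail
    | Order.lt _ _ => fail
    | andb (Order.lt _ _) (Order.le _ _) => fail
    | negb (@eq_op ?T _ _) => tryif unify (Equality.sort T) int then fail else clear H
    | _ => clear H
    end
  end; lia.

Section Runs.
Variables (e : nat) (he : (1 < e)%N) (P : rootlattice e -> Prop).

Lemma sum_of_posroots0 : sum_of_posroots P 0.
Proof. by exists [::]; rewrite big_nil. Qed.

Lemma sum_of_posroots_cons b c :
  posroot b -> P b -> sum_of_posroots P c -> sum_of_posroots P (b + c).
Proof.
move=> hb Pb [s [hs ->]]; exists (b :: s); rewrite big_cons; split=> // d.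
by rewrite inE => /predU1P[->|/hs].
Qed.

(* [q] selects nodes of a ribbon; the selected nodes decompose into maximal runs
   [x' < z <= y'], whose contents are roots. *)
Lemma sum_of_runs (q : int -> bool) (x y : int) : x <= y ->
  (forall x' y', x <= x' -> x' < y' -> y' <= y -> (forall z, x' < z <= y' -> q z) ->
     x' = x \/ ~~ q x' -> y' = y \/ ~~ q (y' + 1) -> P (root_pot e y' - root_pot e x')) ->
  sum_of_posroots P
    (\sum_(n < `|y - x|%N | q (x + 1 + n%:Z)) simple (resid e (x + 1 + n%:Z))).
Proof.
move=> xy HP.
suff IH n s z : x <= s -> s <= z -> z + n%:Z = y -> (forall w, s < w <= z -> q w) ->
    s = x \/ ~~ q s ->
    sum_of_posroots P (root_pot e z - root_pot e s +
      \sum_(k < n | q (z + 1 + k%:Z)) simple (resid e (z + 1 + k%:Z))).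
  rewrite -[X in sum_of_posroots _ X]add0r -[X in X + _](subrr (root_pot e x)).
  apply: IH; rewrite ?lexx //; first by lia.
    by move=> w; lia.
  by left.
have emit (u v : int) c : x <= u -> u <= v -> v <= y -> (forall w, u < w <= v -> q w) ->
    u = x \/ ~~ q u -> v = y \/ ~~ q (v + 1) -> sum_of_posroots P c ->
    sum_of_posroots P (root_pot e v - root_pot e u + c).
  move=> xu; rewrite le_eqVlt => /predU1P[->|uv]; first by rewrite subrr add0r.
  move=> vy qq qu qv; apply: sum_of_posroots_cons; last exact: HP.
  by apply/(posrootP he); exists u, v.
elim: n s z => [|n IH] s z xs sz zn qq qs.
  have zy : z = y by lia.
  rewrite big_ord0; apply: (emit s z _ xs sz _ qq qs); [lia | by left | exact: sum_of_posroots0].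
rewrite big_mkcond big_ord_recl -big_mkcond /= addr0.
have E : \sum_(k < n | q (z + 1 + (bump 0 k)%:Z)) simple (resid e (z + 1 + (bump 0 k)%:Z)) =
    \sum_(k < n | q (z + 1 + 1 + k%:Z)) simple (resid e (z + 1 + 1 + k%:Z)).
  have F (k : 'I_n) : z + 1 + (bump 0 k)%:Z = z + 1 + 1 + k%:Z by rewrite /bump; lia.
  by apply: eq_big => k; rewrite F.
rewrite {}E; case: ifP => qz; last first.
  rewrite add0r; apply: (emit s z _ xs sz _ qq qs); [lia | by right; rewrite qz | ].
  rewrite -[X in sum_of_posroots _ X]add0r -[X in X + _](subrr (root_pot e (z + 1))).
  apply: IH; rewrite ?lexx //; try lia.
rewrite addrA [_ - _ + _]addrAC -root_potS //; apply: IH => //; try lia.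
move=> w hw; case: (eqVneq w (z + 1)) => [->//|wz]; apply: qq; lia.
Qed.

End Runs.

Section TwoTiles.
Variables (l : nat) (tau nu1 nu2 : {fset node l}).
Hypothesis tab : skew_tableau tau [fset nu1; nu2] [:: nu1; nu2].

Lemma two_tiles_nonempty : nu1 != fset0 /\ nu2 != fset0.
Proof.
case: tab => -[h _ _] _ _.
by split; [case: (h nu1) | case: (h nu2)] => //; rewrite !inE eqxx ?orbT.
Qed.

Lemma two_tiles_cover u : (u \in tau) = (u \in nu1) || (u \in nu2).
Proof.
case: tab => -[_ _ <-] _ _; apply/bigfcupP/orP => /= [[B]|[h|h]].
- by rewrite !inE andbT => /orP[] /eqP -> ->; [left | right].
- by exists nu1; rewrite // !inE eqxx.
- by exists nu2; rewrite // !inE eqxx orbT.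
Qed.

Lemma two_tiles_disjoint u : u \in nu1 -> u \notin nu2.
Proof.
case: tab => -[_ tr _] pe _ u1; apply/negP => u2.
have : nu1 != nu2.
  by have := perm_uniq pe; rewrite fset_uniq /= inE andbT => ->.
move/trivIfsetP: tr => tr /(tr nu1 nu2); rewrite !inE !eqxx orbT => /(_ isT isT).
by move/fdisjointP/(_ u u1)/negP.
Qed.

Lemma two_tiles_order u v : u \in nu2 -> v \in nu1 -> u.1 = v.1 -> ~~ southeast u.2 v.2.
Proof.
case: tab => _ _ h hu hv uv; apply/negP => se.
by have := h 1%N 0%N u v isT isT hu hv uv se.
Qed.

End TwoTiles.

Definition removable l (N : 'I_l -> int -> int) (r : 'I_l) (x y : int) : bool :=
  [&& x < y, bead (N r) y & ~~ bead (N r) x].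

Lemma removable_lt l (N : 'I_l -> int -> int) r x y : removable N r x y -> x < y.
Proof. by case/and3P. Qed.

Section Geometry.
Variables (l : nat) (kappa : 'I_l -> int) (M : nat) (N : 'I_l -> int -> int) (la : {fset node l}).
Hypothesis repr : represents kappa M N la.

Lemma represents_northwest r u v : (r, v) \in la -> 1 <= u.1 -> kappa r + 1 <= u.2 ->
  southeast u v -> (r, u) \in la.
Proof.
case: u v => [a c] [a' c'] h /= a1 c1 se; have [sk _] := represents_multipartition repr r.
have [h1 h3] : 1 <= a' /\ kappa r + 1 <= c' by move: h; rewrite repr.2 => /and3P[].
have o : (1, kappa r + 1) \in component la r.
  have h2 : a' <= N r (c' - a') by move: h; rewrite repr.2 => /and3P[].
  rewrite in_component repr.2; apply/and3P; split=> //; rewrite addrK.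
  have [?|?] := lerP (c' - a') (kappa r).
    have := profile_mono (repr.1 r) (_ : c' - a' <= kappa r); lia.
  have := profile_mono (repr.1 r) (_ : kappa r <= c' - a'); lia.
rewrite -in_component; apply: (sk _ _ (a', c') o _ _ se); first by rewrite in_component.
by rewrite /southeast a1.
Qed.

Lemma represents_quadrant r u : (r, u) \in la -> 1 <= u.1 /\ kappa r + 1 <= u.2.
Proof. by case: u => a c; rewrite repr.2 => /and3P[]. Qed.

(** The bead of the first row lies at or beyond every occupied diagonal. On an occupied diagonal
    [N z + z] exceeds its initial value kappa, and this quantity grows only across a gap, so there
    is a gap further left. *)
Lemma exists_removable : la != fset0 -> exists r x y, removable N r x y.
Proof.
case/fset0Pn => -[r [a c]]; rewrite repr.2 => /and3P[a1 aN c1].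
have pr := repr.1 r.
have [y by_ Ny] := bead_at_height pr (lexx 1).
have zy : c - a <= y.
  rewrite leNgt; apply/negP => lt; have := bead_succ by_.
  by have := profile_mono pr (_ : y + 1 <= c - a); lia.
suff [x xz nx] : exists2 x, x < c - a & ~~ bead (N r) x.
  by exists r, x, y; rewrite /removable by_ nx andbT; lia.
have H n : kappa r < N r (- M%:Z + n%:Z) + (- M%:Z + n%:Z) ->
    exists2 x, x < - M%:Z + n%:Z & ~~ bead (N r) x.
  elim: n => [|n IH]; first by rewrite addr0 (pr.2 _).2 //; lia.
  have -> : - M%:Z + n.+1%:Z = - M%:Z + n%:Z + 1 by lia.
  case: (boolP (bead (N r) (- M%:Z + n))) => [b h|nb _]; last by exists (- M%:Z + n) => //; lia.
  have [|x xn nx] := IH; first by move: h; rewrite (bead_succ b); lia.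
  by exists x => //; lia.
have [lt|ge] := ltrP (c - a) (- M%:Z).
  by exfalso; move: aN; rewrite ((pr.2 (c - a)).2 (ltW lt)); lia.
have := H `|(c - a + M)%R|%N.
have -> : - M%:Z + `|(c - a + M)%R|%N = c - a by lia.
by apply; lia.
Qed.

Lemma removable_bounds r x y : removable N r x y -> - M%:Z <= x /\ y < M.
Proof.
case/and3P=> _ by_ bx.
by split; [exact: (nbead_low (repr.1 r) bx) | exact: (bead_high (repr.1 r) by_)].
Qed.

End Geometry.

Section RemovableRim.
Variables (l : nat) (kappa : 'I_l -> int) (M : nat) (N : 'I_l -> int -> int) (la : {fset node l}).
Hypothesis repr : represents kappa M N la.
Variables (r : 'I_l) (x y : int).
Hypothesis rem : removable N r x y.

Let xy : x < y. Proof. by case/and3P: rem. Qed.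
Let by_ : bead (N r) y. Proof. by case/and3P: rem. Qed.
Let bx : ~~ bead (N r) x. Proof. by case/and3P: rem. Qed.
Let sub := (rim_removal repr xy by_ bx).1.
Let repr' := (rim_removal repr xy by_ bx).2.

(** If v were outside the rim hook it would survive its removal; what remains is a multipartition,
    so u, northwest of v, would survive too. *)
Lemma rim_southeast_closed u v : u \in rim N r x y -> v \in la -> u.1 = v.1 ->
  southeast u.2 v.2 -> v \in rim N r x y.
Proof.
case: u v => [s u] [s' v] /= ur vl ss se; rewrite -{}ss in vl *; apply/negPn/negP => vr.
have ul := fsubsetP sub _ ur; have [u1 u2] := represents_quadrant repr ul.
have : (s, u) \in la `\` rim N r x y.
  by apply: (represents_northwest repr' _ u1 u2 se); rewrite in_fsetD vr.
by rewrite in_fsetD ur.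
Qed.

Lemma rim_skew : Defs.skew (rim N r x y).
Proof.
move=> s u v w; rewrite !in_component => us ws uv vw.
have [sk _] := represents_multipartition repr s.
have vl : v \in component la s.
  by apply: (sk u v w) => //; rewrite in_component (fsubsetP sub).
by apply: (rim_southeast_closed us) => //; rewrite -in_component.
Qed.

Lemma rim_ribbon : ribbon (rim N r x y).
Proof.
split; [|exact: rim_skew|].
  apply/fset0Pn; exists (rim_node N r y); apply/(rimP _ _ _ (ltW xy)); exists y => //.
  by rewrite xy lexx.
exists r, [seq (rim_node N r (x + 1 + n%:Z)).2 | n <- iota 0 `|y - x|%N]; split; last first.
  by move=> u; rewrite mem_rim -map_comp.
apply/(sortedP (0, 0)) => i; rewrite size_map size_iota => hi.
rewrite !(nth_map 0%N) ?size_iota ?nth_iota //; try lia.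
rewrite !add0n /north_or_east /rim_node /= !xpair_eqE.
have -> : x + 1 + i.+1%:Z = x + 1 + i%:Z + 1 by lia.
(* Along the rim a bead is a step north and a gap is a step east. *)
have [b|nb] := boolP (bead (N r) (x + 1 + i%:Z)).
  by rewrite (bead_succ b); apply/orP; left; lia.
by rewrite (nbead_succ (repr.1 r) nb); apply/orP; right; lia.
Qed.

End RemovableRim.

(** * Cuspidality of a minimal removable rim hook *)

Section MinimalRim.
Variables (e : nat) (he : (1 < e)%N) (pos : 'Z_e -> nat).
Variables (l : nat) (kappa : 'I_l -> int) (M : nat) (N : 'I_l -> int -> int) (la : {fset node l}).
Hypothesis repr : represents kappa M N la.

Local Notation root_between := (@root_between e).

Lemma content_rim_root N' (r : 'I_l) x y : x <= y -> content e (rim N' r x y) = root_between x y.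
Proof. by move=> xy; rewrite content_rim alphaE'. Qed.

(** The tie-break by length ensures that any shorter removable rim hook has strictly larger
    slope. *)
Definition minimal_removable (r : 'I_l) (x y : int) : Prop :=
  removable N r x y /\ forall s x' y', removable N s x' y' ->
    slope_ge pos (root_between x' y') (root_between x y) /\
    (slope_cmp pos (root_between x y) (root_between x' y') = 0 -> y - x <= y' - x').

Variables (r : 'I_l) (x y : int).
Hypothesis min : minimal_removable r x y.

Let rem : removable N r x y := min.1.
Let xy : x < y. Proof. by case/and3P: rem. Qed.
Let by_ : bead (N r) y. Proof. by case/and3P: rem. Qed.
Let bx : ~~ bead (N r) x. Proof. by case/and3P: rem. Qed.

Lemma shorter_removable_slope s x' y' : removable N s x' y' -> y' - x' < y - x ->
  0 < lead_coef (slope_cmp pos (root_between x y) (root_between x' y')).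
Proof.
move=> /(min.2 s x' y')[ge le] lt; rewrite lt_def {1}/root_between lead_coef_eq0 ge andbT.
by apply/eqP => /le; lia.
Qed.

(* Cut the rim hook into two tiles. The runs of the southeast tile are shorter removable rim hooks,
   so they have larger slope. The complement in the rim hook of a run of the northwest tile consists
   of at most two shorter removable rim hooks, so by additivity the run has smaller slope. *)
Lemma minimal_rim_cuspidal : cuspidal (slope_ge pos) (rim N r x y).
Proof.
split; first exact: (rim_skew repr rem).
  by rewrite content_rim_root ?ltW //; apply: posroot_root_between.
move=> nu1 nu2 tab; rewrite content_rim_root ?ltW //.
have [n1 n2] := two_tiles_nonempty tab.
have cov := two_tiles_cover tab.
have dis := two_tiles_disjoint tab.
have ord := two_tiles_order tab.
have sub1 : nu1 `<=` rim N r x y by apply/fsubsetP => u; rewrite cov => ->.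
have sub2 : nu2 `<=` rim N r x y by apply/fsubsetP => u; rewrite cov orbC => ->.
pose nd z := rim_node N r z.
have in2 z : x < z <= y -> (nd z \in nu2) = (nd z \notin nu1).
  move=> xzy; have : nd z \in rim N r x y by apply/(rimP _ _ _ (ltW xy)); exists z.
  by rewrite cov; have := dis (nd z); case: (_ \in nu1) => /= [h _|_ ->//]; apply/negbTE/h.
(* At a bead z the node of z + 1 lies north of that of z, at a gap it lies west to east; the
   southeast tile [nu2] is closed in the corresponding direction. *)
have bead2 z : x < z -> z < y -> bead (N r) z -> nd (z + 1) \in nu2 -> nd z \in nu2.
  move=> xz zy b h; rewrite in2; last by ilia.
  apply/negP => h1; have := ord _ _ h h1 erefl.
  by rewrite /southeast /= (bead_succ b); ilia.
have nbead2 z : x < z -> z < y -> ~~ bead (N r) z -> nd z \in nu2 -> nd (z + 1) \in nu2.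
  move=> xz zy b h; rewrite in2; last by ilia.
  apply/negP => h1; have := ord _ _ h h1 erefl.
  by rewrite /southeast /= (nbead_succ (repr.1 r) b); ilia.
have ex1 : exists2 z, x < z <= y & nd z \in nu1.
  have [u u1] := fset0Pn _ n1; have /(rimP _ _ _ (ltW xy))[z xzy uE] := fsubsetP sub1 _ u1.
  by exists z => //; rewrite /nd -uE.
have ex2 : exists2 z, x < z <= y & nd z \in nu2.
  have [u u1] := fset0Pn _ n2; have /(rimP _ _ _ (ltW xy))[z xzy uE] := fsubsetP sub2 _ u1.
  by exists z => //; rewrite /nd -uE.
split.
  rewrite (content_sub_rim _ sub1).
  apply: (sum_of_runs he (q := fun z => nd z \in nu1)); first exact: ltW.
  move=> x' y' xx' x'y' y'y run Lx Ly.
  have px : x < x' -> bead (N r) x'.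
    move=> lt; apply/negPn/negP => nb; case: Lx => [E|nx]; first by ilia.
    have : nd x' \in nu2 by rewrite in2 ?nx //; ilia.
    move/(nbead2 _ lt _ nb); rewrite in2; last by ilia.
    by rewrite run; [move/(_ (lt_le_trans x'y' y'y)) | ilia].
  have py : y' < y -> ~~ bead (N r) y'.
    move=> lt; apply/negP => b; case: Ly => [E|ny]; first by ilia.
    have : nd (y' + 1) \in nu2 by rewrite in2 ?ny //; ilia.
    move/(bead2 _ _ lt b); rewrite in2; last by ilia.
    by rewrite run; [move/(_ (le_lt_trans xx' x'y')) | ilia].
  (* The complement of the run consists of the pieces from x to x' and from y' to y; they are not
     both empty because [nu2] has a node. *)
  have nz : 0 < lead_coef (slope_cmp pos (root_between x y) (root_between x x') +
      slope_cmp pos (root_between x y) (root_between y' y)).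
    have dx : x < x' -> 0 < lead_coef (slope_cmp pos (root_between x y) (root_between x x')).
      by move=> lt; apply: (@shorter_removable_slope r); [rewrite /removable lt px | ilia].
    have dy : y' < y -> 0 < lead_coef (slope_cmp pos (root_between x y) (root_between y' y)).
      by move=> lt; apply: (@shorter_removable_slope r); [rewrite /removable lt by_ py | ilia].
    have rr z : root_between z z = 0 by rewrite /root_between subrr.
    have s0 : slope_cmp pos (root_between x y) 0 = 0 by exact: raddf0.
    case: (eqVneq x x') => [E|nx].
      case: (eqVneq y' y) => [E'|ny].
        have [z2 z2xy z2n] := ex2; have : nd z2 \in nu1 by apply: run; rewrite -E E'.
        by move/dis; rewrite z2n.
      by rewrite E rr -E s0 add0r; apply: dy; ilia.
    case: (eqVneq y' y) => [E'|ny].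
      by rewrite E' rr s0 addr0; apply: dx; ilia.
    by apply: lead_coefD_gt0; [apply: ltW; apply: dx | apply: dy]; ilia.
  have tot : slope_cmp pos (root_between x y) (root_between x' y') =
      - (slope_cmp pos (root_between x y) (root_between x x') +
         slope_cmp pos (root_between x y) (root_between y' y)).
    apply/eqP; rewrite -addr_eq0 addrCA addrA -!slope_cmpD -addrA.
    by rewrite !root_betweenD slope_cmpxx.
  split; rewrite /slope_ge.
    by rewrite slope_cmpC tot opprK ltW.
  by rewrite tot lead_coefN oppr_ge0 leNgt nz.
rewrite (content_sub_rim _ sub2).
apply: (sum_of_runs he (q := fun z => nd z \in nu2)); first exact: ltW.
move=> x' y' xx' x'y' y'y run Lx Ly.
have px : ~~ bead (N r) x'.
  case: Lx => [->//|nx]; apply/negP => b.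
  case: (eqVneq x' x) => [E|ne]; first by move: b; rewrite E (negPf bx).
  by move/negP: nx; apply; apply: bead2 => //; [ilia | ilia | apply: run; ilia].
have py : bead (N r) y'.
  case: Ly => [->//|ny]; apply/negPn/negP => nb.
  case: (eqVneq y' y) => [E|ne]; first by move: nb; rewrite E by_.
  by move/negP: ny; apply; apply: nbead2 => //; [ilia | ilia | apply: run; ilia].
have rem' : removable N r x' y' by rewrite /removable x'y' py px.
(* Equality would put the whole rim hook in [nu2], while [nu1] has a node. *)
have short : y' - x' < y - x.
  rewrite ltNge; apply/negP => ge.
  have [z1 z1xy z1n] := ex1; have : nd z1 \in nu2 by apply: run; ilia.
  by rewrite in2 // z1n.
have := shorter_removable_slope rem' short; rewrite -/(root_between x' y') => lt.
split; first exact: ltW.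
by rewrite /slope_ge slope_cmpC lead_coefN oppr_ge0 leNgt lt.
Qed.

End MinimalRim.

(** * Existence of the tiling *)

(** Totality and transitivity are asked on the list only, because transitivity of [slope_ge] is
    available for positive heights only. *)
Lemma seq_minimum (T : eqType) (le : T -> T -> Prop) (s : seq T) : s != [::] ->
  (forall x y, x \in s -> y \in s -> le x y \/ le y x) ->
  (forall x y z, x \in s -> y \in s -> z \in s -> le x y -> le y z -> le x z) ->
  exists2 m, m \in s & forall x, x \in s -> le m x.
Proof.
elim: s => // a s IH _ tot tr; have [s0|s0] := eqVneq s [::].
  exists a; rewrite s0 ?inE // => x; rewrite inE => /eqP ->.
  by case: (tot a a); rewrite ?inE ?eqxx.
have in_s z : z \in s -> z \in a :: s by rewrite inE orbC => ->.
have [||m ms mm] := IH s0.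
- by move=> x y xs ys; apply: tot; apply: in_s.
- by move=> x y z xs ys zs; apply: tr; apply: in_s.
have a_s : a \in a :: s by rewrite inE eqxx.
have [am|ma] := tot a m a_s (in_s m ms).
  exists a => // x; rewrite inE => /predU1P[->|xs]; first by case: (tot a a).
  by apply: (tr _ _ _ a_s (in_s m ms) (in_s x xs) am (mm x xs)).
by exists m; rewrite ?in_s // => x; rewrite inE => /predU1P[->|/mm].
Qed.

Section Tiling.
Variables (e : nat) (he : (1 < e)%N) (pos : 'Z_e -> nat).
Variables (l : nat) (kappa : 'I_l -> int).
Implicit Types (M : nat) (N : 'I_l -> int -> int) (la : {fset node l}).

Local Notation root_between := (@root_between e).
Local Notation R := (slope_ge pos).

Lemma root_height_gt0 (x y : int) : x < y -> 0 < height (root_between x y).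
Proof. by move=> xy; apply: (posroot_height_gt0 he); apply: posroot_root_between. Qed.

Lemma exists_minimal_removable M N la : represents kappa M N la -> la != fset0 ->
  exists r x y, minimal_removable pos N r x y.
Proof.
move=> repr la0.
(* By [removable_bounds] both ends lie in the window, so the candidates are finitely many; ends are
   coded after a shift by [M]. *)
pose T : finType := ('I_l * ('I_(M + M) * 'I_(M + M)))%type.
pose lo (p : T) : int := (p.2.1 : nat)%:Z - M%:Z; pose hi (p : T) : int := (p.2.2 : nat)%:Z - M%:Z.
pose rt p := root_between (lo p) (hi p).
pose cand : seq T := [seq p <- enum {: T} | removable N p.1 (lo p) (hi p)].
have candP r x y : removable N r x y -> exists2 p, p \in cand & [/\ p.1 = r, lo p = x & hi p = y].
  move=> rem; have [b1 b2] := removable_bounds repr rem; have lt := removable_lt rem.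
  have h1 : (`|(x + M)%R| < M + M)%N by lia.
  have h2 : (`|(y + M)%R| < M + M)%N by lia.
  have E : lo (r, (Ordinal h1, Ordinal h2)) = x /\ hi (r, (Ordinal h1, Ordinal h2)) = y.
    by rewrite /lo /hi /=; lia.
  exists (r, (Ordinal h1, Ordinal h2)); last by case: E.
  by rewrite mem_filter mem_enum E.1 E.2 rem.
have cand_rem p : p \in cand -> removable N p.1 (lo p) (hi p) by rewrite mem_filter => /andP[].
have ht p : p \in cand -> 0 < height (rt p).
  by move=> /cand_rem/removable_lt; apply: root_height_gt0.
have cand0 : cand != [::].
  have [r [x [y /candP[p pc _]]]] := exists_removable repr la0.
  by apply/eqP => E; rewrite E in pc.
have [||m mc mmin] := seq_minimum (le := fun p q => R (rt q) (rt p)) cand0.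
- move=> p q _ _; rewrite /slope_ge slope_cmpC lead_coefN oppr_ge0.
  by apply/orP; apply: le_total.
- by move=> p q s pc qc sc pq qs; apply: (slope_ge_trans _ _ _ qs pq); apply: ht.
(* Second stage: the shortest candidate among those of minimal slope. *)
pose cand' : seq T := [seq p <- cand | slope_cmp pos (rt m) (rt p) == 0].
have cand'0 : cand' != [::].
  have : m \in cand' by rewrite mem_filter slope_cmpxx eqxx.
  by case: cand'.
have [||n nc nmin] := seq_minimum (le := fun p q => hi p - lo p <= hi q - lo q) cand'0.
- by move=> p q _ _; apply/orP; apply: le_total.
- by move=> p q s _ _ _; apply: le_trans.
move: nc; rewrite mem_filter => /andP[/eqP nm nc].
have mn : R (rt m) (rt n) by rewrite /slope_ge slope_cmpC nm oppr0 lead_coef0.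
exists n.1, (lo n), (hi n); split=> [|r x y /candP[p pc [_ <- <-]]]; first exact: cand_rem.
split=> [|E]; first by apply: (slope_ge_trans _ _ _ (mmin p pc) mn); apply: ht.
(* A candidate with the slope of n has the slope of m as well, hence took part in the second
   stage. *)
apply: nmin; rewrite mem_filter pc andbT; apply/eqP; apply: lead_coef_eq0_sgn; first exact: mmin.
rewrite -slope_cmpC; apply: (slope_ge_trans (ht _ mc) (ht _ nc) (ht _ pc) mn).
by rewrite /slope_ge slope_cmpC E oppr0 lead_coef0.
Qed.

(* A rim hook that becomes removable only after the bead has moved from y to x starts at y or ends
   at x; glued to the removed one it is removable before the move. *)
Lemma removable_after_move N la M r x y s x' y' : represents kappa M N la ->
  minimal_removable pos N r x y -> removable (move_family N r y x) s x' y' ->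
  R (root_between x' y') (root_between x y).
Proof.
move=> repr [/and3P[xy by_ bx] min].
have ge t u v : u < v -> bead (N t) v -> ~~ bead (N t) u -> R (root_between u v) (root_between x y).
  by move=> uv bv bu; apply: (min t u v _).1; rewrite /removable uv bv bu.
have self : slope_cmp pos (root_between x y) (root_between x y) = 0 by exact: slope_cmpxx.
case/and3P=> xy'; rewrite /move_family; case: (eqVneq s r) => [_|_]; last exact: ge.
have xny : x != y by lia.
rewrite !(bead_move (repr.1 r) _ xny by_ bx) negb_or negb_and negbK.
case/orP=> [/eqP y'x|/andP[by' y'y]] /andP[x'x /orP[bx'|/eqP x'y]].
- rewrite y'x in xy' *; rewrite /slope_ge.
  have -> : slope_cmp pos (root_between x y) (root_between x' x) =
      slope_cmp pos (root_between x y) (root_between x' y).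
    by rewrite -(root_betweenD e x' x y) slope_cmpD self addr0.
  by apply: (ge r) => //; lia.
- by move: xy'; rewrite y'x x'y ltNge (ltW xy).
- exact: (ge r).
- rewrite x'y in xy' *; rewrite /slope_ge.
  have -> : slope_cmp pos (root_between x y) (root_between y y') =
      slope_cmp pos (root_between x y) (root_between x y').
    by rewrite -(root_betweenD e x y y') slope_cmpD self add0r.
  by apply: (ge r) => //; lia.
Qed.

Lemma cuspidal_Kostant_tiling0 : cuspidal_Kostant_tiling R (fset0 : {fset node l}) fset0.
Proof.
have til : skew_tiling (fset0 : {fset node l}) fset0.
  split=> //; first by apply/trivIfsetP => A.
  by apply/fsetP => u; rewrite in_fset0; apply/negP => /bigfcupP[B].
by split=> //; exists [::]; split=> [|a [|b]//]; split.
Qed.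

(** Induction on the number of nodes. The minimal rim hook is southeast closed and goes last in the
    tableau; the lower bound on tiles is carried along because, with [removable_after_move], it
    shows that the earlier tiles succeed or equal the new one. *)
Lemma exists_Kostant_tiling n M N la : (#|` la| <= n)%N -> represents kappa M N la ->
  exists2 G, cuspidal_Kostant_tiling R la G &
    forall xi, xi \in G -> exists r x y, removable N r x y /\ R (content e xi) (root_between x y).
Proof.
elim: n N la => [|n IH] N la lan repr; have [la0|la0] := eqVneq la fset0.
1,3: by exists fset0; rewrite ?la0 //; apply: cuspidal_Kostant_tiling0.
  by move: lan; rewrite leqn0 cardfs_eq0 (negPf la0).
have [r [x [y min]]] := exists_minimal_removable repr la0.
have rem := min.1; have /and3P[xy by_ bx] := rem.
have [sub repr'] := rim_removal repr xy by_ bx.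
set xi := rim N r x y in sub repr'; set la' := la `\` xi in repr'.
have [rib0 _ _] := rim_ribbon repr rem.
have xiE : content e xi = root_between x y by apply: content_rim_root => //; apply: ltW.
have lan' : (#|` la'| <= n)%N.
  have := fsubset_leq_card sub; have : (0 < #|` xi|)%N by rewrite cardfs_gt0.
  by rewrite /la' cardfsDS // -/xi; clear -lan; lia.
have [G [[hG trG covG] cusG [t [[_ pt ordt] mont]]] lowG] := IH _ _ lan' repr'.
have dis nu : nu \in G -> [disjoint xi & nu]%fset.
  move=> nuG; apply/fdisjointP => u uxi; apply/negP => unu.
  have : u \in la' by rewrite -covG; apply/bigfcupP; exists nu; rewrite ?nuG.
  by rewrite inE uxi.
have xiG : xi \notin G.
  apply/negP => /dis; have [u uxi] := fset0Pn _ rib0.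
  by move/fdisjointP/(_ u uxi); rewrite uxi.
have til : skew_tiling la (xi |` G).
  split.
  - move=> nu /fset1UP[->|/hG//]; split=> //; exact: (rim_skew repr rem).
  - apply/trivIfsetP => A B /fset1UP[->|AG] /fset1UP[->|BG]; rewrite ?eqxx //.
    + by move=> _; apply: dis.
    + by move=> _; rewrite fdisjoint_sym; apply: dis.
    + by move/trivIfsetP: trG; apply.
  - apply/fsetP => u; apply/bigfcupP/idP => [[B]|ula].
      rewrite andbT => /fset1UP[->|BG] uB; first exact: (fsubsetP sub).
      have : u \in la' by rewrite -covG; apply/bigfcupP; exists B; rewrite ?BG.
      by rewrite inE => /andP[].
    have [uxi|uxi] := boolP (u \in xi); first by exists xi; rewrite ?fset1U1.
    have : u \in la' by rewrite inE uxi.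
    rewrite -covG => /bigfcupP[B]; rewrite andbT => BG uB.
    by exists B; rewrite // fset1Ur.
have lowR nu : nu \in G -> R (content e nu) (content e xi).
  move=> nuG; have [s [x' [y' [rem' nuR]]]] := lowG nu nuG; rewrite xiE.
  have lt := removable_lt rem'; have := removable_after_move repr min rem'.
  apply: slope_ge_trans nuR; try exact: root_height_gt0.
  by apply: (posroot_height_gt0 he); case: (cusG nu nuG) => -[].
exists (xi |` G); last first.
  move=> nu /fset1UP[->|nuG]; first by exists r, x, y; rewrite xiE /slope_ge slope_cmpxx lead_coef0.
  by exists r, x, y; rewrite -xiE; split=> //; apply: lowR.
split=> //.
  move=> nu /fset1UP[->|/cusG//]; split; last exact: (rim_ribbon repr rem).
  exact: (minimal_rim_cuspidal he repr min).
exists (rcons t xi); split.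
  split=> //.
    rewrite perm_rcons; apply: uniq_perm => [||nu]; last by rewrite !inE (perm_mem pt).
      by rewrite cons_uniq (perm_mem pt) xiG (perm_uniq pt) fset_uniq.
    exact: fset_uniq.
  move=> a b u v; rewrite size_rcons !ltnS !nth_rcons.
  rewrite (leq_eqVlt a) (leq_eqVlt b) => /predU1P[->|lta] /predU1P[->|ltb] //;
    rewrite ?ltnn ?eqxx ?lta ?ltb.
  (* A node of an earlier tile southeast of a node of the last tile would belong to the last
     tile. *)
  - move=> uxi vt uv se; exfalso.
    have : v \in xi.
      apply: (rim_southeast_closed repr rem uxi _ uv se).
      have : v \in la'.
        by rewrite -covG; apply/bigfcupP; exists (nth fset0 t b); rewrite -?(perm_mem pt) ?mem_nth.
      by rewrite inE => /andP[].
    apply/negP; apply: (fdisjointP (_ : [disjoint nth fset0 t b & xi]%fset)) vt.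
    by rewrite fdisjoint_sym; apply: dis; rewrite -(perm_mem pt) mem_nth.
  - by move=> _ _ _ _; apply: ltnW.
  - exact: ordt.
move=> a b ab; rewrite size_rcons ltnS !nth_rcons => bt.
have at_ := leq_trans ab bt.
move: at_ bt; rewrite (leq_eqVlt a) (leq_eqVlt b) => /predU1P[at_|lta] /predU1P[bt|ltb].
- rewrite at_ bt ltnn eqxx /slope_ge slope_cmpxx lead_coef0 //.
- by move: ab; rewrite at_ leqNgt ltb.
- by rewrite lta bt ltnn eqxx; apply: lowR; rewrite -(perm_mem pt) mem_nth.
- by rewrite lta ltb; apply: mont.
Qed.

End Tiling.

(** * The order on residues of a convex preorder *)

Section ResidueOrder.
Variables (e : nat) (he : (1 < e)%N) (R : rootlattice e -> rootlattice e -> Prop).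
Hypothesis cvx : convex_preorder R.
Implicit Types (x y z : int) (b c : rootlattice e).
Local Notation rt := (@root_between e).
Local Notation delta := (delta e).

Lemma delta_multiple x (m : nat) : delta *+ m = rt x (x + m%:Z * e).
Proof. by rewrite /root_between root_potD // addrC addKr pmulrn. Qed.

(** The telescoping form of an injective function on residues vanishes on delta, hence separates end
    residues. *)
Lemma resid_delta_multiple x y (m : nat) : rt x y = delta *+ m -> resid e x = resid e y.
Proof.
rewrite (delta_multiple x) => /(congr1 (telescope (fun i : 'Z_e => (i : nat)%:Z))).
rewrite !telescope_root //.
have <- : resid e x = resid e (x + m%:Z * e) by apply/(eq_resid he); exists m.
by rewrite subrr => /eqP; rewrite subr_eq0 => /eqP [] E; apply/val_inj.
Qed.

Lemma imaginary_root x y : x < y -> resid e x = resid e y ->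
  exists2 m : nat, (1 <= m)%N & rt x y = delta *+ m.
Proof.
move=> xy /(eq_resid he)[k yE]; exists `|k|%N; first by nia.
by rewrite (delta_multiple x); congr (rt x _); nia.
Qed.

Lemma posroot_delta : posroot delta.
Proof. by rewrite -[delta]mulr1n (delta_multiple 0); apply: posroot_root_between => //; lia. Qed.

Lemma equiv_delta b : posroot b -> (R b delta /\ R delta b) <->
  exists2 m : nat, (1 <= m)%N & b = delta *+ m.
Proof.
move=> hb; rewrite (cvx_equiv cvx hb posroot_delta); split.
  by case=> [->|[m [n [m1 n1 -> _]]]]; [exists 1%N | exists m].
by case=> m m1 ->; right; exists m, 1%N.
Qed.

Definition above x y : Prop := x < y /\ strict R (rt x y) delta.
Definition below x y : Prop := x < y /\ strict R delta (rt x y).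

Lemma above_irr x y : resid e x = resid e y -> ~ above x y.
Proof.
move=> xy [lt [_]]; apply; have := imaginary_root lt xy.
by move/(equiv_delta (posroot_root_between he lt)) => [].
Qed.

Lemma below_irr x y : resid e x = resid e y -> ~ below x y.
Proof.
move=> xy [lt [_]]; apply; have := imaginary_root lt xy.
by move/(equiv_delta (posroot_root_between he lt)) => [].
Qed.

Lemma above_or_below x y : x < y -> resid e x <> resid e y -> above x y \/ below x y.
Proof.
move=> lt ne; have pr := posroot_root_between he lt.
have no : ~ (R (rt x y) delta /\ R delta (rt x y)).
  by move/(equiv_delta pr) => [m _ /resid_delta_multiple].
case: (cvx_total cvx pr posroot_delta) => h; [left | right]; split=> //; split=> // h'; exact: no.
Qed.

Lemma not_above_below x y : above x y -> ~ below x y.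
Proof. by move=> [_ [a _]] [_ [_]]; apply. Qed.

(** By convexity the sum succeeds or equals the smaller of the two roots, which already succeeds
    delta. *)
Lemma above_trans y x z : above x y -> above y z -> above x z.
Proof.
move=> [xy [h1 n1]] [yz [h2 n2]]; have xz := lt_trans xy yz.
have [pxy pyz] := (posroot_root_between he xy, posroot_root_between he yz).
have pxz := posroot_root_between he xz.
have pd := posroot_delta.
split=> //; rewrite -(root_betweenD e x y z).
have E : rt x y + rt y z = rt x z by exact: root_betweenD.
have [h|h] := cvx_total cvx pxy pyz.
  have [|_ h3] := cvx_convex cvx pxy pyz _ h; first by rewrite E.
  rewrite E in h3 *; split; first exact: (cvx_trans cvx pxz pyz pd).
  by move=> h4; apply: n2; apply: (cvx_trans cvx pd pxz pyz).
have [|_ h3] := cvx_convex cvx pyz pxy _ h; first by rewrite addrC E.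
rewrite addrC E in h3 *; split; first exact: (cvx_trans cvx pxz pxy pd).
by move=> h4; apply: n1; apply: (cvx_trans cvx pd pxz pxy).
Qed.

Lemma below_trans y x z : below x y -> below y z -> below x z.
Proof.
move=> [xy [h1 n1]] [yz [h2 n2]]; have xz := lt_trans xy yz.
have [pxy pyz] := (posroot_root_between he xy, posroot_root_between he yz).
have pxz := posroot_root_between he xz.
have pd := posroot_delta.
split=> //; have E : rt x y + rt y z = rt x z by exact: root_betweenD.
have [h|h] := cvx_total cvx pxy pyz.
  have [|h3 _] := cvx_convex cvx pxy pyz _ h; first by rewrite E.
  rewrite E in h3 *; split; first exact: (cvx_trans cvx pd pxy pxz).
  by move=> h4; apply: n1; apply: (cvx_trans cvx pxy pxz pd).
have [|h3 _] := cvx_convex cvx pyz pxy _ h; first by rewrite addrC E.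
rewrite addrC E in h3 *; split; first exact: (cvx_trans cvx pd pyz pxz).
by move=> h4; apply: n2; apply: (cvx_trans cvx pyz pxz pd).
Qed.

Lemma resid_shift x (k : int) : resid e (x + k * e) = resid e x.
Proof. by apply/esym/(eq_resid he); exists k. Qed.

Lemma resid_adde x : resid e (x + e) = resid e x.
Proof. by rewrite -[e%:Z]mul1r resid_shift. Qed.

Lemma rt_shift x y (k : int) : rt (x + k * e) (y + k * e) = rt x y.
Proof. by apply: root_pot_eq; rewrite ?resid_shift //; lia. Qed.

Lemma above_translate x y (k : int) : above x y -> above (x + k * e) (y + k * e).
Proof. by move=> [xy h]; split; [lia | rewrite rt_shift]. Qed.

Lemma delta_rt x : delta = rt x (x + e).
Proof. by rewrite -[LHS]mulr1n (delta_multiple x) mul1r. Qed.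

(** Adding delta to a root above delta keeps it at least delta by convexity, and the sum is not
    imaginary. *)
Lemma above_extend x y : above x y -> above x (y + e).
Proof.
move=> a; have [xy [h _]] := a; have xye : x < y + e by lia.
have [|//|b] := above_or_below xye.
  by rewrite resid_adde => /above_irr /(_ a).
have pxy := posroot_root_between he xy; have pd := posroot_delta.
have E : rt x y + delta = rt x (y + e) by rewrite (delta_rt y) root_betweenD.
have [|_ h2] := cvx_convex cvx pxy pd _ h; first by rewrite E; apply: posroot_root_between.
by case: b => _ [_ []]; rewrite -E.
Qed.

Lemma below_extend x y : below x y -> below x (y + e).
Proof.
move=> a; have [xy [h _]] := a; have xye : x < y + e by lia.
have [|b|//] := above_or_below xye.
  by rewrite resid_adde => /below_irr /(_ a).
have pxy := posroot_root_between he xy; have pd := posroot_delta.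
have E : delta + rt x y = rt x (y + e) by rewrite addrC (delta_rt y) root_betweenD.
have [|h2 _] := cvx_convex cvx pd pxy _ h; first by rewrite E; apply: posroot_root_between.
by case: b => _ [_ []]; rewrite -E.
Qed.

Lemma above_shrink x y : x < y -> above x (y + e) -> above x y.
Proof.
move=> xy a; case: (above_or_below xy) => [|//|/below_extend b].
  by move=> E; apply: (above_irr _ a); rewrite resid_adde.
by case: (not_above_below a b).
Qed.

(** [above] depends only on the residues of the ends: translate both ends by a multiple of e, then
    adjust the length by one e at a time with [above_extend] or [above_shrink]. *)
Lemma above_resid x y x' y' : resid e x = resid e x' -> resid e y = resid e y' ->
  x' < y' -> above x y -> above x' y'.
Proof.
move=> /(eq_resid he)[k ->] /(eq_resid he)[k' ->] lt a.
have {lt} : x < y + (k' - k) * e by nia.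
suff H : x < y + (k' - k) * e -> above x (y + (k' - k) * e).
  move=> /H /(above_translate k); congr (above _ _); nia.
have : x < y by case: a.
case: (lerP 0 (k' - k)) => kk; move: (k' - k) kk => j j0 xy.
  have -> : j = `|j|%N by lia.
  elim: `|j|%N => [|n IH]; first by rewrite mul0r addr0.
  have -> : y + n.+1%:Z * e = y + n%:Z * e + e by nia.
  by move=> _; apply: above_extend; apply: IH; nia.
have -> : j = - `|j|%N%:Z by lia.
elim: `|j|%N => [|n IH]; first by rewrite oppr0 mul0r addr0.
move=> lt; apply: above_shrink => //.
have -> : y + - n.+1%:Z * e + e = y + - n%:Z * e by nia.
by apply: IH; nia.
Qed.

(** The shift by [e] makes the right end exceed the left one for any two representatives in
    [0, e-1]. *)
Definition resid_lt (i j : 'Z_e) : Prop := above (i : nat)%:Z ((j : nat)%:Z + e).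

Lemma Ze_lt (i : 'Z_e) : (i < e)%N.
Proof. by have := ltn_ord i; rewrite [X in (_ < X)%N -> _](Zp_cast he). Qed.

Lemma resid_ltE x y : x < y -> resid_lt (resid e x) (resid e y) <-> above x y.
Proof.
have E z : resid e ((resid e z : nat)%:Z + e) = resid e z.
  by rewrite resid_adde resid_nat.
move=> xy; split=> h; apply: above_resid h; rewrite ?resid_nat ?E //.
have := Ze_lt (resid e x); lia.
Qed.

Lemma resid_lt_irr i : ~ resid_lt i i.
Proof. by apply: above_irr; rewrite resid_adde. Qed.

Lemma resid_lt_trans j i k : resid_lt i j -> resid_lt j k -> resid_lt i k.
Proof.
move=> ij jk; have {}jk := above_translate 1 jk; rewrite mul1r in jk.
apply: above_resid (above_trans ij jk) => //.
  by rewrite !resid_adde.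
have := Ze_lt i; lia.
Qed.

(** If neither held, two roots below delta would concatenate to an imaginary root below delta. *)
Lemma resid_lt_total i j : i <> j -> resid_lt i j \/ resid_lt j i.
Proof.
have lt0 (u v : 'Z_e) : (u : nat)%:Z < (v : nat)%:Z + e by have := Ze_lt u; lia.
have E (u : 'Z_e) : resid e ((u : nat)%:Z + e) = u by rewrite resid_adde resid_nat.
move=> ne; have [|h|b1] := above_or_below (lt0 i j); first by rewrite E resid_nat.
  by left.
have [|h|b2] := above_or_below (lt0 j i); first by rewrite E (resid_nat he) => /esym.
  by right.
have b2' : below ((j : nat)%:Z + e) ((i : nat)%:Z + e + e).
  case: b2 => lt h; split; first by lia.
  by have := rt_shift (j : nat)%:Z ((i : nat)%:Z + e) 1; rewrite !mul1r => ->.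
have := below_trans b1 b2'; move/below_irr; case.
by rewrite !resid_adde.
Qed.

Lemma residue_rank : exists pos : 'Z_e -> nat, [/\ injective pos, forall i, (pos i < e)%N &
  forall x y, x < y -> ((pos (resid e x) < pos (resid e y))%N <-> strict R (rt x y) delta)].
Proof.
(* Classical logic makes the order boolean, so that the rank of a residue can be the number of its
   predecessors. *)
have dec (i j : 'Z_e) : exists b : bool, b <-> resid_lt i j.
  by case: (classic (resid_lt i j)) => h; [exists true | exists false]; split.
have /fin_all_exists[b bP] := fun i => fin_all_exists (dec i).
pose pos i := #|[pred j | b j i]|.
have mono i j : resid_lt i j -> (pos i < pos j)%N.
  move=> ij; apply: proper_card; apply/properP; split.
    apply/subsetP => k; rewrite !inE => /bP ki; apply/bP; exact: resid_lt_trans ki ij.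
  by exists i; rewrite inE; [apply/bP | apply/negP => /bP /resid_lt_irr].
have posE i j : (pos i < pos j)%N <-> resid_lt i j.
  split=> [lt|]; last exact: mono.
  have [E|/eqP /resid_lt_total[//|/mono]] := eqVneq i j; first by rewrite E ltnn in lt.
  by rewrite ltnNge (ltnW lt).
exists pos; split.
- move=> i j E; apply/eqP/negPn/negP => /eqP /resid_lt_total[] /mono; rewrite E ltnn //.
- move=> i; rewrite -[X in (_ < X)%N](Zp_cast he) -[X in (_ < X)%N]card_ord; apply: proper_card.
  apply/properP; split; first by apply/subsetP.
  by exists i; rewrite ?inE //; apply/negP => /bP /resid_lt_irr.
move=> x y xy; rewrite posE resid_ltE //.
by split=> [[]|h]; last split.
Qed.

End ResidueOrder.

(** * Southeast closed subsets of a tiled diagram *)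

Section Cut.
Variables (l : nat) (tau S : {fset node l}).
Hypothesis S_closed : forall u v, u \in S -> v \in tau -> u.1 = v.1 -> southeast u.2 v.2 -> v \in S.

Lemma sum_fsetI (V : zmodType) (F : node l -> V) (A : {fset node l}) :
  \sum_(u <- A) (if u \in S then F u else 0) = \sum_(u <- A `&` S) F u.
Proof.
rewrite -big_mkcond -[LHS]big_filter; apply: perm_big; apply: uniq_perm.
- exact/filter_uniq/fset_uniq.
- exact: fset_uniq.
by move=> u; rewrite mem_filter inE andbC.
Qed.

Lemma content_tiling e G : skew_tiling tau G -> S `<=` tau ->
  content e S = \sum_(A <- G) content e (A `&` S).
Proof.
case=> _ tr cov sub; rewrite /content -[in LHS](fsetIidPr sub) -sum_fsetI -cov big_trivIfset //.
by apply: eq_bigr => A _; rewrite sum_fsetI.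
Qed.

Lemma cut_tile nu : Defs.skew nu -> nu `<=` tau -> nu `&` S != fset0 -> nu `\` S != fset0 ->
  skew_tableau nu [fset nu `\` S; nu `&` S] [:: nu `\` S; nu `&` S].
Proof.
move=> sk sub n2 n1; set nu1 := nu `\` S in n1 *; set nu2 := nu `&` S in n2 *.
have closed s u v : (s, u) \in S -> (s, v) \in nu -> southeast u v -> (s, v) \in S.
  by move=> us vn se; apply: (@S_closed (s, u) (s, v) us _ _ se) => //; apply: (fsubsetP sub).
have ne : nu1 != nu2.
  apply/eqP => E; have [u un2] := fset0Pn _ n2.
  have : (u \in nu1) && (u \in nu2) by rewrite E andbb.
  by rewrite !inE; case: (u \in S); rewrite ?andbF.
have sk1 : Defs.skew nu1.
  move=> s u v w; rewrite !in_component !inE => /andP[uS un] /andP[wS wn] uv vw.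
  have vn : (s, v) \in nu by rewrite -in_component; apply: (sk s u v w); rewrite ?in_component.
  by rewrite vn andbT; apply: contra wS => vS; exact: (closed _ _ _ vS wn vw).
have sk2 : Defs.skew nu2.
  move=> s u v w; rewrite !in_component !inE => /andP[un uS] /andP[wn wS] uv vw.
  have vn : (s, v) \in nu by rewrite -in_component; apply: (sk s u v w); rewrite ?in_component.
  by rewrite vn; exact: (closed _ _ _ uS vn uv).
split.
- split.
  + by move=> B; rewrite !inE => /orP[] /eqP ->.
  + apply/trivIfsetP => A B; rewrite !inE.
    move=> /orP[] /eqP -> /orP[] /eqP -> //; rewrite ?eqxx // => _.
      by apply/fdisjointP => u; rewrite !inE => /andP[/negPf -> _]; rewrite andbF.
    by apply/fdisjointP => u; rewrite !inE => /andP[_ ->].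
  + apply/fsetP => u; apply/bigfcupP/idP => [[B]|un].
      by rewrite !inE andbT => /orP[] /eqP ->; rewrite !inE => /andP[].
    have [uS|uS] := boolP (u \in S).
      by exists nu2; rewrite !inE ?eqxx ?orbT // un uS.
    by exists nu1; rewrite !inE ?eqxx // un uS.
- by apply: uniq_perm => [||B]; rewrite ?fset_uniq //= !inE ?ne ?orbF.
move=> [|[|a]] [|[|b]] // [s u] [s' v] _ _ /=; rewrite !inE => /andP[_ uS] /andP[vS vn] E se.
by rewrite -E in vS vn; rewrite (closed s u v) in vS.
Qed.

End Cut.

Section Lower.
Variables (e : nat) (R : rootlattice e -> rootlattice e -> Prop).
Hypothesis cvx : convex_preorder R.
Variables (l : nat) (tau S : {fset node l}).
Hypothesis S_closed : forall u v, u \in S -> v \in tau -> u.1 = v.1 -> southeast u.2 v.2 -> v \in S.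

Lemma content0 : content e (fset0 : {fset node l}) = 0.
Proof. by rewrite /content big_seq_fset0. Qed.

Lemma height_content (A : {fset node l}) : height (content e A) = #|` A|%:Z.
Proof.
rewrite /content raddf_sum /= (eq_bigr (fun _ => 1)) => [|u _]; last exact: height_simple.
by rewrite big_const_seq iter_addr_0 count_predT natz.
Qed.

(** If the tile lies inside S, its own content is the decomposition; otherwise S cuts it into two
    tiles with the S part second, and cuspidality applies. *)
Lemma cuspidal_cut nu : cuspidal R nu -> nu `<=` tau -> nu `&` S != fset0 ->
  sum_of_posroots (fun c => R c (content e nu)) (content e (nu `&` S)).
Proof.
case=> sk pr cut sub n2; have [E|n1] := eqVneq (nu `\` S) fset0.
  have -> : nu `&` S = nu by apply/fsetIidPl; rewrite -fsetD_eq0 E.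
  exists [:: content e nu]; rewrite big_seq1; split=> // c; rewrite inE => /eqP ->.
  by split=> //; apply: (cvx_refl cvx).
have [_ [s [hs sE]]] := cut _ _ (cut_tile S_closed sk sub n2 n1).
by exists s; split=> // c /hs[? []].
Qed.

(** Each nonempty piece of S contributes at least m, the empty ones contribute 0, and there is a
    nonempty piece. The value m = 0 serves the RoCK case and m = 1 the core case. *)
Lemma lower_set_functional (f : {additive rootlattice e -> int}) (P : rootlattice e -> Prop)
    (m : int) G :
  0 <= m ->
  (forall b c, posroot b -> posroot c -> R b c -> P c -> m <= f b) ->
  S `<=` tau -> S != fset0 ->
  cuspidal_Kostant_tiling R tau G -> (forall xi, xi \in G -> P (content e xi)) ->
  m <= f (content e S).
Proof.
move=> m0 fP sub S0 [til cus _] PG; rewrite (content_tiling _ til sub) raddf_sum.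
have [u uS] := fset0Pn _ S0.
have [_ _ cov] := til.
have subA A : A \in G -> A `<=` tau.
  by move=> AG; apply/fsubsetP => v vA; rewrite -cov; apply/bigfcupP; exists A; rewrite ?AG.
have piece A : A \in G -> A `&` S != fset0 -> m <= f (content e (A `&` S)).
  move=> AG n; have [cA _] := cus A AG.
  have [s [hs sE]] := cuspidal_cut cA (subA A AG) n.
  have ge c : c \in s -> m <= f c.
    by case/hs=> pc Rc; apply: (fP c (content e A)) => //; [case: cA | apply: PG].
  (* The height of a content counts nodes, so a nonempty piece has a nonempty decomposition. *)
  have s0 : s != [::].
    apply/eqP => s0; move: n; rewrite -cardfs_eq0 -eqz_nat -height_content sE s0 big_nil.
    by rewrite [height 0]raddf0.
  rewrite sE raddf_sum /=; case: s s0 ge {hs sE} => // c s _ ge.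
  rewrite big_cons; have := ge c (mem_head c s).
  have : 0 <= \sum_(j <- s) f j.
    rewrite big_seq sumr_ge0 // => d ds; apply: le_trans m0 (ge d _).
    by rewrite inE ds orbT.
  by move=> h1 h2; exact: ler_wpDr.
have [A AG uA] : exists2 A, A \in G & u \in A.
  have : u \in fcover G by rewrite cov (fsubsetP sub).
  by move/bigfcupP => [A]; rewrite andbT => AG uA; exists A.
rewrite (big_fsetD1 A) //=.
have : m <= f (content e (A `&` S)).
  by apply: piece => //; apply/fset0Pn; exists u; rewrite inE uA.
have : 0 <= \sum_(B <- G `\ A) f (content e (B `&` S)).
  rewrite big_seq sumr_ge0 // => B /fsetD1P[_ BG].
  have [->|n] := eqVneq (B `&` S) fset0; first by rewrite content0 raddf0.
  exact: le_trans m0 (piece B BG n).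
by move=> h1 h2; exact: ler_wpDr.
Qed.

End Lower.

(** * From tilings to inequalities between ranks of residues *)

Section Necessity.
Variables (e : nat) (he : (1 < e)%N) (R : rootlattice e -> rootlattice e -> Prop).
Hypothesis cvx : convex_preorder R.
Variable pos : 'Z_e -> nat.
Hypothesis posP : forall x y, x < y ->
  ((pos (resid e x) < pos (resid e y))%N <-> strict R (root_between e x y) (delta e)).

Let f : {additive rootlattice e -> int} := telescope (fun i : 'Z_e => (pos i)%:Z).

Lemma f_root x y : f (root_between e x y) = (pos (resid e y))%:Z - (pos (resid e x))%:Z.
Proof. exact: telescope_root. Qed.

Lemma f_gt0 b : posroot b -> strict R b (delta e) -> 1 <= f b.
Proof.
by move=> /(posrootP he)[x [y [xy ->]]] /(posP xy); rewrite f_root; lia.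
Qed.

Lemma f_ge0 b : posroot b -> R b (delta e) -> 0 <= f b.
Proof.
move=> pb Rb; case: (classic (R (delta e) b)) => [Rd|nRd]; last first.
  by have := f_gt0 pb (conj Rb nRd); lia.
have [x [y [xy bE]]] := (posrootP he b).1 pb; rewrite bE f_root.
have [m m1] := (equiv_delta he cvx pb).1 (conj Rb Rd); rewrite bE => /(resid_delta_multiple he) ->.
by rewrite subrr.
Qed.

Variables (l : nat) (kappa : 'I_l -> int) (M : nat) (N : 'I_l -> int -> int) (la : {fset node l}).
Hypothesis repr : represents kappa M N la.

Lemma removable_functional r x y (P : rootlattice e -> Prop) (m : int) : 0 <= m ->
  (forall b c, posroot b -> posroot c -> R b c -> P c -> m <= f b) ->
  Kostant_tiles_satisfy R P la -> removable N r x y ->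
  m <= (pos (resid e y))%:Z - (pos (resid e x))%:Z.
Proof.
move=> m0 fP [G [tG hG]] rem; have /and3P[xy by_ bx] := rem.
have [sub _] := rim_removal repr xy by_ bx.
rewrite -f_root -(content_rim_root he N r (ltW xy)).
apply: (lower_set_functional cvx _ m0 fP sub _ tG hG).
  by move=> u v; apply: (rim_southeast_closed repr rem).
by case: (rim_ribbon repr rem).
Qed.

Lemma removable_pos_le r x y : Kostant_tiles_satisfy R (fun c => R c (delta e)) la ->
  removable N r x y -> (pos (resid e x) <= pos (resid e y))%N.
Proof.
move=> K rem; have fP b c : posroot b -> posroot c -> R b c -> R c (delta e) -> 0 <= f b.
  by move=> pb pc bc cd; apply: f_ge0 => //; apply: (cvx_trans cvx pb pc (posroot_delta he)).
by have := removable_functional (lexx 0) fP K rem; lia.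
Qed.

Lemma removable_pos_lt r x y : Kostant_tiles_satisfy R (fun c => strict R c (delta e)) la ->
  removable N r x y -> (pos (resid e x) < pos (resid e y))%N.
Proof.
move=> K rem; have pd := posroot_delta he.
have fP b c : posroot b -> posroot c -> R b c -> strict R c (delta e) -> 1 <= f b.
  move=> pb pc bc [cd ndc]; apply: f_gt0 => //; split; first exact: (cvx_trans cvx pb pc pd).
  by move=> db; apply: ndc; apply: (cvx_trans cvx pd pb pc).
by have := removable_functional ler01 fP K rem; lia.
Qed.

End Necessity.

(** * Core blocks *)

Lemma int_maximum (P : int -> Prop) (B : int) : (exists z, P z) -> (forall z, P z -> z <= B) ->
  exists2 m, P m & forall z, P z -> z <= m.
Proof.
move=> [z0 Pz0] bd.
suff H n z : P z -> B <= z + n%:Z -> exists2 m, P m & forall z', P z' -> z' <= m.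
  by apply: (H `|(B - z0)%R|%N z0 Pz0); lia.
elim: n z => [|n IH] z Pz zB; first by exists z => // w /bd; lia.
case: (classic (exists2 w, P w & z < w)) => [[w Pw zw]|no]; first by apply: (IH w Pw); lia.
by exists z => // w Pw; rewrite leNgt; apply/negP => zw; apply: no; exists w.
Qed.

(** * Potentials on a weighted complete digraph *)

Section Potential.
Variables (T : finType) (w : T -> T -> int).

Fixpoint path_weight (i : T) (p : seq T) : int :=
  if p is j :: q then w i j + path_weight j q else 0.

Lemma path_weight_cat i p q :
  path_weight i (p ++ q) = path_weight i p + path_weight (last i p) q.
Proof. by elim: p i => [|j p IH] i /=; rewrite ?add0r // IH addrA. Qed.

Lemma path_weight_rcons i p j : path_weight i (rcons p j) = path_weight i p + w (last i p) j.
Proof. by rewrite -cats1 path_weight_cat /= addr0. Qed.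

(* [b j] is the largest weight of a simple path ending in j. *)
Lemma potential_exists :
  (forall i q, uniq (i :: q) -> path_weight i (rcons q i) <= 0) ->
  exists b : T -> int, forall i j, b i + w i j <= b j.
Proof.
move=> cyc.
pose P j v := exists s p, [/\ uniq (s :: p), last s p = j & path_weight s p = v].
have [b bP] : exists b : T -> int, forall j, P j (b j) /\ forall v, P j v -> v <= b j.
  apply: (fin_all_exists (P := fun j v => P j v /\ forall v', P j v' -> v' <= v)) => j.
  pose K := \sum_i \sum_k `|w i k|.
  have K0 : 0 <= K by apply: sumr_ge0 => i _; apply: sumr_ge0.
  have wK i k : w i k <= K.
    apply: le_trans (ler_norm _) _; rewrite /K (bigD1 i) //= (bigD1 k) //= -addrA lerDl.
    by apply: addr_ge0; apply: sumr_ge0 => // i' _; apply: sumr_ge0.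
  have [||m Pm mmax] := @int_maximum (P j) (K * #|T|%:Z).
  - by exists 0, j, [::].
  - move=> _ [s [p [u _ <-]]].
    have pT : (size p <= #|T|)%N.
      by apply: leq_trans (max_card (mem (s :: p))); rewrite (card_uniqP u) leqnSn.
    suff h : path_weight s p <= K * (size p)%:Z.
      by apply: le_trans h _; rewrite ler_wpM2l // lez_nat.
    elim: p s {u pT} => [|k p IH] s //=; first by rewrite mulr0.
    by rewrite -addn1 PoszD mulrDr mulr1 addrC lerD.
  by exists m.
exists b => i j; have [[s [p [u li <-]]] _] := bP i; have [_ bj] := bP j.
have [jsp|jsp] := boolP (j \in s :: p); last first.
  apply: bj; exists s, (rcons p j); rewrite last_rcons path_weight_rcons li -rcons_cons rcons_uniq.
  by rewrite jsp u.
move: jsp u li; rewrite inE => /predU1P[js|].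
  (* The arc closes the path into a cycle, and the empty path at s gives [0 <= b s]. *)
  rewrite {j}js in bj *.
  move=> u li; have := cyc s p u; rewrite path_weight_rcons li => h; apply: le_trans h _.
  by apply: bj; exists s, [::].
(* The path is cut at j: its beginning is a simple path ending in j, and the rest with the new arc
   is a cycle of weight at most 0. *)
case/splitPr => p1 p2; rewrite -cat_rcons => u.
rewrite last_cat last_rcons => li; rewrite path_weight_cat last_rcons.
have u2 : uniq (j :: p2).
  by move: u; rewrite cat_rcons -cat_cons cat_uniq => /and3P[].
have := cyc j p2 u2; rewrite path_weight_rcons li => h.
have : path_weight s (rcons p1 j) <= b j.
  apply: bj; exists s, (rcons p1 j); split; rewrite ?last_rcons //.
  by move: u; rewrite -cat_cons cat_uniq => /and3P[].
by lia.
Qed.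

End Potential.

Section Moves.
Variables (e : nat) (he : (1 < e)%N) (l : nat) (kappa : 'I_l -> int).
Implicit Types (M : nat) (N : 'I_l -> int -> int) (la : {fset node l}).

Lemma content_fsetD la (S : {fset node l}) : S `<=` la ->
  content e la = content e (la `\` S) + content e S.
Proof.
move=> sub; rewrite /content -big_cat; apply: perm_big; apply: uniq_perm.
- exact: fset_uniq.
- rewrite cat_uniq !fset_uniq andbT; apply/hasPn => u uS; apply/negP => /=.
  by rewrite inE [u \in S]uS.
move=> u; rewrite mem_cat; change ((u \in la) = (u \in la `\` S) || (u \in S)).
rewrite !inE; case: (boolP (u \in S)) => [uS|_] /=; last by rewrite orbF.
exact: (fsubsetP sub).
Qed.

Lemma represents_eq M M' N N' la la' : represents kappa M N la -> represents kappa M' N' la' ->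
  (forall r z, N r z = N' r z) -> la = la'.
Proof. by move=> h h' E; apply/fsetP => -[r [a c]]; rewrite h.2 h'.2 E. Qed.

(** A move to the right is the inverse of the removal of a rim hook from the new multipartition,
    whose window has to be enlarged. *)
Lemma represents_move M N la r x y : represents kappa M N la ->
  bead (N r) y -> ~~ bead (N r) x -> exists M' la',
  represents kappa M' (move_family N r y x) la' /\
  content e la' = content e la + root_between e y x.
Proof.
move=> repr by_ bx; case: (ltgtP x y) => [xy|yx|E]; last by rewrite E by_ in bx.
  have [sub repr'] := rim_removal repr xy by_ bx.
  exists M, (la `\` rim N r x y); split=> //.
  rewrite [in RHS](content_fsetD sub) content_rim_root ?(ltW xy) // -addrA.
  by rewrite root_betweenD [root_between e x x]subrr addr0.
pose M' := (M + `|x| + `|y| + 1)%N.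
have pr' := @move_family_profile _ _ _ _ _ repr r x y M'.
have xny : x != y by rewrite gt_eqF.
have {}pr' s : profile M' (kappa s) (move_family N r y x s).
  by apply: pr' => //; rewrite /M'; lia.
have [la' repr'] := profile_represents pr'.
have bm z : bead (move_family N r y x r) z = (z == x) || (bead (N r) z && (z != y)).
  by rewrite /move_family eqxx (bead_move (repr.1 r)).
have b1 : bead (move_family N r y x r) x by rewrite bm eqxx.
have b2 : ~~ bead (move_family N r y x r) y by rewrite bm eqxx andbF orbF eq_sym.
have [sub repr''] := rim_removal repr' yx b1 b2.
exists M', la'; split=> //.
rewrite (content_fsetD sub) content_rim_root ?(ltW yx) //; congr (content e _ + _).
apply: (represents_eq repr'' repr) => s z; rewrite /move_family.
by case: eqP => // ->; rewrite eqxx /move; do 2 case: ifP; lia.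
Qed.

(** Distinct sources and distinct targets keep the later moves legal after the earlier ones. *)
Lemma represents_moves (mv : seq ('I_l * (int * int))) M N la : represents kappa M N la ->
  uniq [seq (m.1, m.2.1) | m <- mv] -> uniq [seq (m.1, m.2.2) | m <- mv] ->
  (forall m, m \in mv -> bead (N m.1) m.2.1 /\ ~~ bead (N m.1) m.2.2) ->
  exists M' N' la', represents kappa M' N' la' /\
    content e la' = content e la + \sum_(m <- mv) root_between e m.2.1 m.2.2.
Proof.
elim: mv M N la => [|[r [y x]] mv IH] M N la repr.
  by exists M, N, la; rewrite big_nil addr0.
move=> /= /andP[ny uy] /andP[nx ux] ok.
have [/= by_ bx] := ok _ (mem_head _ _).
have [M' [la' [repr' la'E]]] := represents_move repr by_ bx.
have xy : x != y by apply: contraTneq by_ => <-.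
have [|M'' [N'' [la'' [repr'' E]]]] := IH _ _ _ repr' uy ux.
  move=> [s [y' x']] sm /=; have [/= by' bx'] := ok _ (mem_behead (s := _ :: _) sm).
  rewrite /move_family; case: (eqVneq s r) => [sr|//].
  rewrite sr in by' bx' sm; rewrite !(bead_move (repr.1 r) _ xy) // by' (negPf bx') /= orbF.
  split; last by apply: contra nx => /eqP <-; apply/mapP; exists (r, (y', x')).
  by apply/orP; right; apply: contra ny => /eqP <-; apply/mapP; exists (r, (y', x')).
exists M'', N'', la''; split; first by [].
by rewrite E la'E big_cons -addrA.
Qed.

Lemma multicoreP M N la : represents kappa M N la ->
  multicore e kappa la <-> forall r (x : int), bead (N r) x -> bead (N r) (x - e%:Z).
Proof.
move=> repr; split=> h r x.
  move=> b; pose k : int := (resid e (kappa r) : nat)%:Z.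
  have /(beta_set_bead repr)/h : bead (N r) (x + k - kappa r - k + kappa r).
    by have -> : x + k - kappa r - k + kappa r = x by lia.
  move/(beta_set_bead repr); rewrite -/k.
  by have -> : x + k - kappa r - e%:Z - k + kappa r = x - e%:Z by lia.
move/(beta_set_bead repr)/h => b; apply/(beta_set_bead repr).
have -> // : x - e%:Z - (resid e (kappa r) : nat)%:Z + kappa r =
  x - (resid e (kappa r) : nat)%:Z + kappa r - e%:Z by lia.
Qed.

Lemma root_pot_resid z :
  root_pot e z = root_pot e (resid e z : nat)%:Z + delta e *~ (z %/ e)%Z.
Proof. by rewrite -root_potD // resid_modz // addrC -divz_eq. Qed.

Section NoGain.
Variables (M : nat) (N : 'I_l -> int -> int) (la : {fset node l}).
Hypothesis repr : represents kappa M N la.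
Hypothesis core : forall mu : {fset node l},
  is_multipartition kappa mu -> content e mu = content e la -> multicore e kappa mu.
Variable w : 'Z_e -> 'Z_e -> int.
Hypothesis wP : forall i j, exists r x y,
  [/\ bead (N r) y, ~~ bead (N r) x, resid e x = i, resid e y = j & w i j = y - x].

(** An arc from i to j is realised by moving a bead of residue j to a gap of residue i. The end
    residues fix the change of content up to a multiple of delta; these multiples accumulate in K,
    which the weight determines by comparing heights. *)
Lemma path_moves i p : exists mv : seq ('I_l * (int * int)), exists K : int,
  [/\ [seq resid e m.2.2 | m <- mv] = belast i p, [seq resid e m.2.1 | m <- mv] = p,
      forall m, m \in mv -> bead (N m.1) m.2.1 /\ ~~ bead (N m.1) m.2.2,
      \sum_(m <- mv) root_between e m.2.1 m.2.2 =
        root_pot e (i : nat)%:Z - root_pot e (last i p : nat)%:Z + delta e *~ K &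
      - path_weight w i p = (i : nat)%:Z - (last i p : nat)%:Z + K * e].
Proof.
elim: p i => [|j p IH] i.
  by exists [::], 0; split; rewrite ?big_nil //= ?mulr0z ?subrr ?addr0 ?mul0r ?oppr0.
have [mv [K [E1 E2 ok E3 E4]]] := IH j; have [r [x [y [by_ bx xi yj wE]]]] := wP i j.
exists ((r, (y, x)) :: mv), (K + (x %/ e)%Z - (y %/ e)%Z); split.
- by rewrite /= E1 xi.
- by rewrite /= E2 yj.
- by move=> m; rewrite inE => /predU1P[->//|/ok].
- rewrite big_cons E3 /= /root_between (root_pot_resid x) (root_pot_resid y) xi yj.
  rewrite mulrzBr mulrzDr !opprD !addrA.
  move: (root_pot e (i : nat)%:Z) (root_pot e (j : nat)%:Z) (root_pot e (last j p : nat)%:Z).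
  move: (delta e *~ (x %/ e)%Z) (delta e *~ (y %/ e)%Z) (delta e *~ K) => a b c A B C.
  by apply/ffunP => k; rewrite !ffunE; ring.
- rewrite /= wE; have := divz_eq x e; have := divz_eq y e.
  rewrite -!resid_modz // xi yj; have := E4; lia.
Qed.

(* Performing the bead moves of a positive cycle lowers the content by a positive multiple k of
   delta; moving the top bead of a component up by k e restores the content and leaves a
   multipartition which is not a multicore. *)
Lemma no_positive_cycle i q : uniq (i :: q) -> path_weight w i (rcons q i) <= 0.
Proof.
move=> u; rewrite leNgt; apply/negP => pw.
have [mv [K [E1 E2 ok E3 E4]]] := path_moves i (rcons q i).
rewrite last_rcons !subrr !add0r in E3 E4.
have K0 : K < 0 by nia.
(* Sources, and likewise targets, are distinct because their residues run once through the simple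
   cycle. *)
have [||M' [N' [la' [repr' la'E]]]] := represents_moves repr _ _ ok.
- apply: (@map_uniq _ _ (fun p => resid e p.2)); rewrite -map_comp.
  by rewrite (_ : map _ _ = rcons q i) // rcons_uniq -cons_uniq.
- apply: (@map_uniq _ _ (fun p => resid e p.2)); rewrite -map_comp.
  by rewrite (_ : map _ _ = i :: q) // -[RHS](belast_rcons i q i).
have [r _] := wP i i.
have [||y0 by0 y0max] := @int_maximum (bead (N' r)) M'.
- by exists (- M'%:Z - 1); apply: (bead_low (repr'.1 r)); lia.
- by move=> z /(bead_high (repr'.1 r))/ltW.
pose x := y0 + `|K|%:Z * e.
have xy : y0 < x by rewrite /x; nia.
have nb z : y0 < z -> ~~ bead (N' r) z by move=> lt; apply/negP => /y0max; lia.
have [M'' [la'' [repr'' la''E]]] := represents_move repr' by0 (nb _ xy).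
have : content e la'' = content e la.
  rewrite la''E la'E E3 /x -(delta_multiple he) pmulrn -addrA -mulrzDr.
  by rewrite (_ : K + `|K|%N%:Z = 0) ?mulr0z ?addr0 //; lia.
move/(core (represents_multipartition repr''))/(multicoreP repr'')/(_ r x).
have ne : x != y0 by rewrite gt_eqF.
rewrite /move_family eqxx !(bead_move (repr'.1 r) _ ne by0 (nb _ xy)) eqxx /= => /(_ isT).
(* The site x - e is a gap: it is either the vacated site y0 or lies beyond the top bead. *)
have -> : (x - e%:Z == x) = false by lia.
case: (eqVneq (x - e%:Z) y0) => [->|ney]; first by rewrite andbF.
by rewrite andbT /= (negPf (nb _ _)) // lt_neqAle eq_sym ney /= /x; nia.
Qed.

End NoGain.

End Moves.

Lemma represents_weaken l (kappa : 'I_l -> int) M M' N (la : {fset node l}) :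
  (M <= M')%N -> represents kappa M N la -> represents kappa M' N la.
Proof. by move=> MM [pr mem]; split=> // r; exact: (profile_weaken (pr r) MM). Qed.

(** * Sums over beads are determined by the content *)

Section BeadSum.
Variables (e : nat) (he : (1 < e)%N) (l : nat) (kappa : 'I_l -> int) (M : nat).
Variables (Phi : {additive rootlattice e -> int}) (g : int -> int).
Hypothesis PhiE : forall x y, Phi (root_between e x y) = g y - g x.
Implicit Types (N : 'I_l -> int -> int) (la : {fset node l}).

(** The sum is truncated to the window, since below it every site is a bead and above it there is
    none. *)
Definition bead_sum N : int :=
  \sum_(r < l) \sum_(k < M + M) g (k%:Z - M%:Z) * (bead (N r) (k%:Z - M%:Z))%:R.

Lemma window_sum1 (x : int) : - M%:Z <= x -> x < M ->
  \sum_(k < M + M) g (k%:Z - M%:Z) * (k%:Z - M%:Z == x)%:R = g x.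
Proof.
move=> x1 x2; have h : (`|(x + M)%R| < M + M)%N by lia.
have E : (`|(x + M)%R|%N)%:Z - M%:Z = x by lia.
rewrite (bigD1 (Ordinal h)) //= E eqxx mulr1 big1 ?addr0 // => k /eqP nk.
rewrite (_ : (_ == x) = false) ?mulr0 //; apply/eqP => kx; apply: nk.
by apply: val_inj => /=; lia.
Qed.

Lemma bead_sum_move N la r x y : represents kappa M N la -> removable N r x y ->
  bead_sum (move_family N r y x) = bead_sum N + (g x - g y).
Proof.
move=> repr rem; have [b1 b2] := removable_bounds repr rem; have /and3P[xy by_ bx] := rem.
have xny : x != y by rewrite lt_eqF.
rewrite /bead_sum (bigD1 r) //= [in RHS](bigD1 r) //= addrAC; congr (_ + _); last first.
  by apply: eq_bigr => s /negPf sr; rewrite /move_family sr.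
rewrite -(window_sum1 b1 (lt_trans xy b2)) -(window_sum1 (le_trans b1 (ltW xy)) b2).
rewrite -sumrB -big_split; apply: eq_bigr => k _ /=.
rewrite /move_family eqxx (bead_move (repr.1 r)) // -mulrBr -mulrDr; congr (_ * _).
move: (k%:Z - M%:Z) => z; case: (eqVneq z x) => [->|zx].
  by rewrite (negPf bx) (negPf xny).
by case: (eqVneq z y) => [->|zy]; rewrite ?by_ ?andbF ?andbT //= ?subr0 ?addr0.
Qed.

(** The subtracted term is the bead sum of the empty multipartition; removing a rim hook from y to x
    lowers both sides by [g y - g x]. *)
Lemma additive_bead_sum N la : represents kappa M N la ->
  Phi (content e la) = bead_sum N - bead_sum (fun r z => Num.max 0 (kappa r - z)).
Proof.
have [n] := ubnP #|` la|; elim: n N la => // n IH N la lan repr.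
have [la0|la0] := eqVneq la fset0.
  rewrite la0 [content _ _]big_seq_fset0 raddf0.
  suff E r z : N r z = Num.max 0 (kappa r - z).
    apply/esym/eqP; rewrite subr_eq0; apply/eqP; rewrite /bead_sum.
    by apply: eq_bigr => r _; apply: eq_bigr => k _; rewrite /bead !E.
  have [N1 N2] := profile_bounds (repr.1 r) z.
  apply/eqP; rewrite eq_le ge_max N1 [_ <= N r z]lerBlDr N2 !andbT.
  rewrite leNgt; apply/negP; rewrite gt_max => /andP[h1 h2].
  suff : (r, (N r z, N r z + z)) \in la by rewrite la0.
  by rewrite repr.2 (_ : N r z + z - N r z = z) ?lexx /=; lia.
have [r [x [y rem]]] := exists_removable repr la0; have /and3P[xy by_ bx] := rem.
have [sub repr'] := rim_removal repr xy by_ bx.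
have [n0 _ _] := rim_ribbon repr rem.
rewrite (content_fsetD e sub) raddfD /= content_rim_root ?(ltW xy) // PhiE.
rewrite (IH _ _ _ repr') ?(bead_sum_move repr rem); last first.
  have := fsubset_leq_card sub; have : (0 < #|` rim N r x y|)%N by rewrite cardfs_gt0.
  by rewrite cardfsDS //; clear -lan; lia.
by ring.
Qed.

End BeadSum.

(** The profile drops by one at each bead, from [kappa r + M] to 0 across the window. *)
Lemma sum_beads l (kappa : 'I_l -> int) M N (la : {fset node l}) r : represents kappa M N la ->
  \sum_(k < M + M) (bead (N r) (k%:Z - M%:Z))%:R = kappa r + M :> int.
Proof.
move=> repr; have pr := repr.1 r.
suff H n : \sum_(k < n) (bead (N r) (k%:Z - M%:Z))%:R = N r (- M%:Z) - N r (n%:Z - M%:Z).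
  rewrite H (pr.2 _).2 // (pr.2 _).1; last by lia.
  by rewrite opprK subr0.
elim: n => [|n IH]; first by rewrite big_ord0 sub0r subrr.
rewrite big_ord_recr /= IH; have -> : n.+1%:Z - M%:Z = n%:Z - M%:Z + 1 by lia.
have [b|nb] := boolP (bead (N r) (n%:Z - M%:Z)).
  by rewrite (bead_succ b) mulr1n; ring.
by rewrite (nbead_succ pr nb) addr0.
Qed.

Section Separation.
Variables (e : nat) (he : (1 < e)%N) (l : nat) (kappa : 'I_l -> int) (M : nat).
Variables (N N' : 'I_l -> int -> int) (la la' : {fset node l}).
Hypotheses (repr : represents kappa M N la) (repr' : represents kappa M N' la').
Hypothesis same : content e la = content e la'.
Variable b : 'Z_e -> int.
Let g (z : int) : int := z - b (resid e z).
Hypothesis sep : forall r x y, bead (N r) y -> ~~ bead (N r) x -> g y <= g x.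

(* In each component the beads of la are, up to ties, the sites where g is at most c. The sum of
   [g - c] over the beads depends only on the content, and la minimises it termwise. *)
Lemma separation_transfer r x y : bead (N' r) y -> ~~ bead (N' r) x -> g y <= g x.
Proof.
have [c cP] : exists c : 'I_l -> int, forall r,
    (forall y, bead (N r) y -> g y <= c r) /\ (forall x, ~~ bead (N r) x -> c r <= g x).
  apply: (fin_all_exists (P := fun r (c : int) =>
    (forall y, bead (N r) y -> g y <= c) /\ (forall x, ~~ bead (N r) x -> c <= g x))) => s.
  have b0 : bead (N s) (- M%:Z - 1) by apply: (bead_low (repr.1 s)); lia.
  have [||m [x0 nx0 ->] mm] := @int_maximum (fun v => exists2 x, ~~ bead (N s) x & v = - g x)
      (- g (- M%:Z - 1)).
  (* The threshold is the minimum of g over the gaps, bounded below by the value of g at the bead -M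
     - 1. *)
  - by exists (- g M%:Z), M%:Z => //; apply: (nbead_high (repr.1 s)).
  - by move=> _ [x' nx' ->]; rewrite lerN2; apply: sep nx'.
  exists (g x0); split=> [y0 by0|x' nx']; first exact: sep nx0.
  by rewrite -lerN2; apply: mm; exists x'.
pose B (P : 'I_l -> int -> int) s (k : 'I_(M + M)) : int := (bead (P s) (k%:Z - M%:Z))%:R.
pose t s (k : 'I_(M + M)) : int := (g (k%:Z - M%:Z) - c s) * (B N' s k - B N s k).
have t0 s k : 0 <= t s k.
  rewrite /t /B; have [c1 c2] := cP s; have := c1 (k%:Z - M%:Z); have := c2 (k%:Z - M%:Z).
  case: (bead (N s) _) => /= h1 h2; [have {}h2 := h2 isT | have {}h1 := h1 isT].
    by case: (bead _ _); rewrite ?subrr ?mulr0 // sub0r mulrN1 oppr_ge0 subr_le0.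
  by case: (bead _ _); rewrite ?subrr ?mulr0 // subr0 mulr1 subr_ge0.
have tsum : \sum_s \sum_k t s k = 0.
  (* The sum of z over the beads is governed by the height and that of [b] by its telescoping form;
     the thresholds cancel because the numbers of beads agree. *)
  have E1 := additive_bead_sum (Phi := @height e) (g := id) he (height_root he).
  have E2 := additive_bead_sum (Phi := telescope b) (g := b \o resid e) he (telescope_root he b).
  have {}E1 : bead_sum M id N' = bead_sum M id N.
    by have := E1 _ _ _ _ _ repr; rewrite same (E1 _ _ _ _ _ repr') => /addIr.
  have {}E2 : bead_sum M (b \o resid e) N' = bead_sum M (b \o resid e) N.
    by have := E2 _ _ _ _ _ repr; rewrite same (E2 _ _ _ _ _ repr') => /addIr.
  have E3 s : \sum_k c s * (B N' s k - B N s k) = 0.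
    by rewrite -mulr_sumr sumrB (sum_beads s repr) (sum_beads s repr') subrr mulr0.
  transitivity (bead_sum M id N' - bead_sum M id N -
      (bead_sum M (b \o resid e) N' - bead_sum M (b \o resid e) N)); last by rewrite E1 E2 !subrr.
  rewrite /bead_sum -!sumrB; apply: eq_bigr => s _.
  rewrite -[RHS]subr0 -[X in _ = _ - X](E3 s) -!sumrB.
  by apply: eq_bigr => k _; rewrite /t /g /B /=; ring.
have tz s (k : 'I_(M + M)) : t s k = 0.
  have ge s' : true -> 0 <= \sum_k' t s' k' by move=> _; apply: sumr_ge0 => k' _.
  have ts : \sum_k' t s k' = 0 by apply: (psumr_eq0P ge tsum).
  by apply: (psumr_eq0P _ ts).
have [c1 c2] := cP r.
(* Each term vanishes, so inside the window the two bead sets differ only where g takes the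
   threshold value. *)
have win z : - M%:Z <= z -> z < M -> g z = c r \/ bead (N' r) z = bead (N r) z.
  move=> z1 z2; have h : (`|(z + M)%R| < M + M)%N by lia.
  have := tz r (Ordinal h); rewrite /t /B /= (_ : (`|(z + M)%R|%N)%:Z - M%:Z = z); last by lia.
  move/eqP; rewrite mulf_eq0 subr_eq0 => /orP[/eqP|]; first by left.
  by case: (bead _ _) (bead _ _) => -[]; right.
move=> by_ bx; apply: (@le_trans _ _ (c r)).
  have [lt|ge] := ltrP y (- M%:Z); first by apply: c1; exact: (bead_low (repr.1 r) lt).
  by have [->//|E] := win y ge (bead_high (repr'.1 r) by_); apply: c1; rewrite -E.
have [lt|ge] := ltrP x M; last by apply: c2; exact: (nbead_high (repr.1 r) ge).
by have [->//|E] := win x (nbead_low (repr'.1 r) bx) lt; apply: c2; rewrite -E.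
Qed.

End Separation.

(** * The theorem *)

Section Blocks.
Variables (e : nat) (he : (1 < e)%N) (l : nat) (kappa : 'I_l -> int) (beta : rootlattice e).

Lemma core_block_rank : core_block kappa beta ->
  exists2 pos : 'Z_e -> nat, injective pos & forall M N (la : {fset node l}) r x y,
    represents kappa M N la -> content e la = beta -> removable N r x y ->
    (pos (resid e x) < pos (resid e y))%N.
Proof.
move=> core.
pose block (la : {fset node l}) := is_multipartition kappa la /\ content e la = beta.
case: (classic (exists la, block la)); last first.
  move=> no; exists (fun i => i : nat) => [i j /val_inj //|M N la r x y repr la_b _].
  by case: no; exists la; split=> //; apply: represents_multipartition repr.
case=> la0 [/multipartition_represents[M0 [N0 repr0]] la0E].
case: (posnP l) => [l0|l0].
  exists (fun i => i : nat) => [i j /val_inj //|M N la r].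
  by have := ltn_ord r; rewrite {2}l0.
have core0 (mu : {fset node l}) :
    is_multipartition kappa mu -> content e mu = content e la0 -> multicore e kappa mu.
  by rewrite la0E; apply: core.
pose E i j v := exists r x y,
  [/\ bead (N0 r) y, ~~ bead (N0 r) x, resid e x = i, resid e y = j & v = y - x].
(* The weight of (i, j) is the longest displacement from a gap of residue i to a bead of residue j;
   it exists since beads are bounded above and gaps below. *)
have [w wP] : exists w : 'Z_e -> 'Z_e -> int,
    forall i j, E i j (w i j) /\ forall v, E i j v -> v <= w i j.
  suff ex i j : exists v, E i j v /\ forall v', E i j v' -> v' <= v.
    have [w wP] := fin_all_exists (fun i => fin_all_exists (ex i)).
    by exists w.
  have [||m Em mm] := @int_maximum (E i j) (M0 + M0)%:Z; last by exists m.
    pose r := Ordinal l0; pose x := (i : nat)%:Z + M0%:Z * e.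
    pose y := (j : nat)%:Z + (- M0%:Z - 1) * e.
    exists (y - x), r, x, y; split=> //.
    - by apply: (bead_low (repr0.1 r)); have := Ze_lt he j; rewrite /y; nia.
    - by apply: (nbead_high (repr0.1 r)); rewrite /x; nia.
    - by rewrite /x resid_shift // resid_nat.
    - by rewrite /y resid_shift // resid_nat.
  move=> v [r [x [y [by_ bx _ _ ->]]]].
  by have := bead_high (repr0.1 r) by_; have := nbead_low (repr0.1 r) bx; lia.
have [b bP] : exists b : 'Z_e -> int, forall i j, b i + w i j <= b j.
  apply: potential_exists => i q; apply: (no_positive_cycle he repr0 core0) => i' j'.
  by case: (wP i' j').
have sep0 r x y : bead (N0 r) y -> ~~ bead (N0 r) x -> y - b (resid e y) <= x - b (resid e x).
  move=> by_ bx; have [_ wm] := wP (resid e x) (resid e y).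
  have := wm (y - x); have := bP (resid e x) (resid e y).
  move=> h /(_ _) h'; have {}h' : y - x <= w (resid e x) (resid e y) by apply: h'; exists r, x, y.
  lia.
(* A bound making every [b i + K] nonnegative, so that the absolute value below loses nothing. *)
pose K := \sum_i `|b i|.
have bK i : - b i <= K.
  apply: (@le_trans _ _ `|b i|); first by rewrite -normrN ler_norm.
  by rewrite /K (bigD1 i) //= lerDl sumr_ge0.
(* The residues sorted by b, ties being broken by their value. *)
exists (fun i => (`|(b i + K)%R| * e + i)%N) => [i j E2|M N la r x y repr la_b rem].
  apply: val_inj => /=; have := congr1 (modn^~ e) E2.
  by rewrite /= !modnMDl !modn_small // Ze_lt.
have /and3P[xy by_ bx] := rem.
have W1 : represents kappa (M0 + M) N0 la0 by apply: represents_weaken repr0; apply: leq_addr.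
have W2 : represents kappa (M0 + M) N la by apply: represents_weaken repr; apply: leq_addl.
have same : content e la0 = content e la by rewrite la0E la_b.
(* With x < y this makes [b] strictly larger at y than at x, which the residue term, less than e,
   cannot undo. *)
have := separation_transfer he W1 W2 same sep0 by_ bx.
have := bK (resid e x); have := bK (resid e y); have := Ze_lt he (resid e x).
move: (resid e x : nat) (resid e y : nat) => i j.
move: (b _) (b _) => u v; clear -xy; nia.
Qed.

Lemma resid_beta z r : resid e (z - (resid e (kappa r) : nat)%:Z + kappa r) = resid e z.
Proof.
apply/(eq_resid he); exists (- (kappa r %/ e)%Z); rewrite resid_modz //.
by have := divz_eq (kappa r) e; lia.
Qed.

(** The beta set is the bead set shifted by a multiple of e, so residues are unchanged. *)
Lemma RoCK_removable M N (la : {fset node l}) (theta : {perm 'I_e}) : represents kappa M N la ->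
  (RoCK kappa theta la <-> forall r x y (a b : 'I_e), removable N r x y ->
    resid e x = theta a :> nat -> resid e y = theta b :> nat -> (a <= b)%N).
Proof.
move=> repr; split=> h r x y a b.
  case/and3P=> xy by_ bx xa yb; pose k := (resid e (kappa r) : nat)%:Z.
  have E z : z + k - kappa r - k + kappa r = z by lia.
  have R z : resid e (z + k - kappa r) = resid e z by rewrite -(resid_beta _ r) E.
  apply: (h r (x + k - kappa r) (y + k - kappa r)); rewrite ?R //; last by lia.
    by apply/(beta_set_bead repr); rewrite -/k E.
  by move/(beta_set_bead repr); rewrite -/k E; apply/negP.
move=> /(beta_set_bead repr) by_ bx xy xa yb.
pose k := (resid e (kappa r) : nat)%:Z.
apply: (h r (x - k + kappa r) (y - k + kappa r)); rewrite ?resid_beta //.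
rewrite /removable by_ andTb; apply/andP; split; first by lia.
by apply/negP => /(beta_set_bead repr).
Qed.

End Blocks.

Theorem theoremC (e : nat) (he : (1 < e)%N) (l : nat) (kappa : 'I_l -> int)
    (beta : {ffun 'Z_e -> int}) (hbeta : nonneg beta) :
  (RoCK_block kappa beta <->
   exists R : {ffun 'Z_e -> int} -> {ffun 'Z_e -> int} -> Prop,
     convex_preorder R /\
     forall la : {fset 'I_l * (int * int)},
       is_multipartition kappa la -> content e la = beta ->
       Kostant_tiles_satisfy R (fun c => R c (delta e)) la)
  /\
  (core_block kappa beta <->
   exists R : {ffun 'Z_e -> int} -> {ffun 'Z_e -> int} -> Prop,
     convex_preorder R /\
     forall la : {fset 'I_l * (int * int)},
       is_multipartition kappa la -> content e la = beta ->
       Kostant_tiles_satisfy R (fun c => strict R c (delta e)) la).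
Proof.
have hd : 0 < height (delta e) by rewrite (delta_root_pot he 0) height_root //; lia.
(* Shared by both forward directions: a property that passes to larger roots and holds for all
   removable rim hooks holds for all tiles. *)
have tiles (pos : 'Z_e -> nat) (P : rootlattice e -> Prop) :
    (forall b c, posroot b -> posroot c -> slope_ge pos b c -> P c -> P b) ->
    (forall M N (la : {fset node l}) r x y, represents kappa M N la -> content e la = beta ->
      removable N r x y -> P (root_between e x y)) ->
    forall la : {fset node l}, is_multipartition kappa la -> content e la = beta ->
    Kostant_tiles_satisfy (slope_ge pos) P la.
  move=> up low la /multipartition_represents[M [N repr]] la_b.
  have [G tG lowG] := exists_Kostant_tiling he pos (leqnn _) repr.
  exists G; split=> // xi xiG; have [r [x [y [rem ge]]]] := lowG xi xiG.
  have pxi : posroot (content e xi) by case: tG => _ cus _; case: (cus xi xiG) => -[].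
  apply: up ge (low _ _ _ _ _ _ repr la_b rem) => //.
  by apply: posroot_root_between => //; apply: removable_lt rem.
split; split.
- case=> theta rock.
  pose cast (i : 'Z_e) : 'I_e := cast_ord (Zp_cast he) i.
  (* The rank of a residue is its index in the sequence theta. *)
  pose pos (i : 'Z_e) : nat := (theta^-1)%g (cast i).
  have pos_inj : injective pos by move=> i j /val_inj /perm_inj /cast_ord_inj.
  exists (slope_ge pos); split; first exact: slope_convex_preorder.
  apply: tiles => //.
    move=> b c pb pc; apply: slope_ge_trans hd; exact: (posroot_height_gt0 he).
  move=> M N la r x y repr la_b rem; apply/(slope_ge_delta he).
  have := (RoCK_removable he theta repr).1 (rock la (represents_multipartition repr) la_b).
  by move/(_ r x y _ _ rem); apply; rewrite permKV.
- case=> R [cvx hR]; have [pos [pos_inj pos_e posP]] := residue_rank he cvx.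
  pose p (i : 'I_e) : 'I_e := Ordinal (pos_e (cast_ord (esym (Zp_cast he)) i)).
  have p_inj : injective p by move=> i j [] /pos_inj /cast_ord_inj.
  (* Inverting the rank lists the residues in increasing order. *)
  exists ((perm p_inj)^-1)%g => la mp la_b.
  have [M [N repr]] := multipartition_represents mp.
  apply/(RoCK_removable he _ repr) => r x y a b rem xa yb.
  have key z (c : 'I_e) : resid e z = ((perm p_inj)^-1)%g c :> nat -> pos (resid e z) = c.
    move=> zc; have -> : c = perm p_inj ((perm p_inj)^-1 c)%g by rewrite permKV.
    by rewrite permE /=; congr pos; apply: val_inj.
  rewrite -(key _ _ xa) -(key _ _ yb).
  exact: (removable_pos_le he cvx posP repr (hR la mp la_b) rem).
- move=> /(core_block_rank he)[pos pos_inj posP].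
  exists (slope_ge pos); split; first exact: slope_convex_preorder.
  apply: tiles => //; last first.
    move=> M N la r x y repr la_b rem.
    by apply: slope_gt_delta => //; apply: posP repr la_b rem.
  move=> b c pb pc bc [cd ndc].
  have [b0 c0] := (posroot_height_gt0 he pb, posroot_height_gt0 he pc).
  split; first exact: slope_ge_trans bc cd.
  by move=> db; apply: ndc; apply: slope_ge_trans db bc.
case=> R [cvx hR] la mp la_b; have [pos [pos_inj pos_e posP]] := residue_rank he cvx.
have [M [N repr]] := multipartition_represents mp.
apply/(multicoreP he repr) => r x bx; apply/negPn/negP => nb.
(* A bead x with a gap at x - e gives a removable rim hook whose ends have the same residue, against
   the strict inequality of ranks. *)
have rem : removable N r (x - e%:Z) x by rewrite /removable bx nb; lia.
have := removable_pos_lt he cvx posP repr (hR la mp la_b) rem.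
suff -> : resid e (x - e%:Z) = resid e x by rewrite ltnn.
by apply/(eq_resid he); exists 1; lia.
Qed.
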